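(* Let $N=\binom n2$, let $0<p<1$ be a real (depending on $n$) and $0<m<N$ an integer satisfying $m=pN$ and $p\gg n^{-1/2}$. Let $X_n$ denote the number of Hamilton cycles in $\mathcal G(n,m)$ (or $\mathcal G(n,p)$). Let $\mu_n=\mathbf E_{\mathcal G(n,m)}X_n$ and $\lambda_n=\mathbf E_{\mathcal G(n,p)}X_n$. Then $X_n/\mu_n\xrightarrow{p}1$ in $\mathcal G(n,m)$. Assume further that $\limsup_{n\to\infty}p(n)<1$; then $$\frac{\ln\bigl(e^{\beta_n^2/2}X_n/\lambda_n\bigr)}{\beta_n}\xrightarrow{d}\mathcal N(0,1)\quad\text{in }\mathcal G(n,p),$$ where $\beta_n=\sqrt{2(1-p)/p}$.
   Context: $\mathcal G(n,m)$ is the uniformly random graph on vertex set $[n]$ with exactly $m$ edges; $\mathcal G(n,p)$ is the binomial random graph on $[n]$ with edge probability $p$. Limits are as $n\to\infty$; $a\gg b$ means $b=o(a)$. $\mathcal N(0,1)$ is the standard normal distribution; $\xrightarrow{p}$, $\xrightarrow{d}$ denote convergence in probability and in distribution. *)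

(* Defs.v *)
From HB Require Import structures.
From mathcomp Require Export all_boot all_order all_algebra.
From mathcomp Require Export all_classical all_reals all_analysis.

Set Implicit Arguments.
Unset Strict Implicit.
Unset Printing Implicit Defensive.

Export Order.TTheory GRing.Theory Num.Theory.
Export numFieldNormedType.Exports.

Local Open Scope ring_scope.

(* Discrete probability: a distribution on a finite type is given by its
   probability mass function w. *)

Definition Pr (R : realType) (T : finType) (w : T -> R) (A : pred T) : R :=
  \sum_(x | A x) w x.

Definition Ex (R : realType) (T : finType) (w : T -> R) (X : T -> R) : R :=
  \sum_x w x * X x.

(* Graphs with vertex set 'I_n, identified with their edge sets. *)

Definition edge (n : nat) : finType := {e : {set 'I_n} | #|e| == 2%N}.

Definition graph (n : nat) : finType := {set edge n}.

Definition gnm (R : realType) (n m : nat) (G : graph n) : R :=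
  (#|G| == m)%:R / #|[set H : graph n | #|H| == m]|%:R.

Definition gnp (R : realType) (n : nat) (p : R) (G : graph n) : R :=
  p ^+ #|G| * (1 - p) ^+ #|~: G|.

(* C is the edge set {s_0 s_1, ..., s_(n-2) s_(n-1), s_(n-1) s_0} for some
   enumeration s of the vertices; a cycle has at least three vertices. *)
Definition hamilton_cycle (n : nat) (C : graph n) : bool :=
  (2 < n)%N &&
  [exists s : n.-tuple 'I_n,
     uniq s && ([set val e | e in C] == [set [set x; next s x] | x : 'I_n])].

(* Cycles are counted as subgraphs, without starting point or orientation. *)
Definition num_hamilton_cycles (n : nat) (G : graph n) : nat :=
  #|[set C : graph n | hamilton_cycle C & C \subset G]|.

Lemma card_edge (n : nat) : #|edge n| = 'C(n, 2).
Proof.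
rewrite card_sig -[in RHS](card_ord n) -card_draws.
by apply: eq_card => A; rewrite !inE.
Qed.

Lemma gnm_sum1 (R : realType) (n m : nat) : (m <= 'C(n, 2))%N ->
  \sum_(G : graph n) gnm R m G = 1.
Proof.
move=> le_mN; rewrite -mulr_suml -natr_sum.
have -> : (\sum_(G : graph n) (#|G| == m))%N = #|[set H : graph n | #|H| == m]|.
  rewrite -sum1_card [RHS]big_mkcond /=.
  by apply: eq_bigr => G _; rewrite inE; case: eqP.
by rewrite divff// pnatr_eq0 card_draws card_edge -lt0n bin_gt0.
Qed.

Lemma gnp_sum1 (R : realType) (n : nat) (p : R) :
  \sum_(G : graph n) gnp p G = 1.
Proof.
have -> : 1 = \prod_(e : edge n) (p + (1 - p)) :> R.
  by rewrite big1// => e _; rewrite addrC subrK.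
rewrite bigA_distr /=; apply: eq_bigr => G _.
rewrite (bigID (mem G)) /= /gnp -!prodr_const; congr (_ * _).
  by apply: eq_bigr => e ->.
by apply: eq_big => e; rewrite inE // => /negbTE ->.
Qed.

Local Open Scope classical_set_scope.

Definition cvg_in_probability (R : realType) (T : nat -> finType)
    (w : forall n, T n -> R) (Y : forall n, T n -> R) (a : R) : Prop :=
  forall eps : R, 0 < eps ->
    Pr (w n) (fun g => eps < `|Y n g - a|) @[n --> \oo] --> 0.

(* The variables may take the values -oo and +oo, but the limit mu is a
   probability measure on the real line: since its distribution function tends
   to 0 at -oo and to 1 at +oo, convergence forces the mass at -oo and +oo to
   vanish in the limit. *)
Definition cvg_in_distribution (R : realType) (T : nat -> finType)
    (w : forall n, T n -> R) (Y : forall n, T n -> \bar R)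
    (mu : probability (measurableTypeR R) R) : Prop :=
  forall x : R, {for x, continuous (fun y : R => mu `]-oo, y]%classic)} ->
    (Pr (w n) (fun g => (Y n g <= x%:E)%E))%:E @[n --> \oo] --> mu `]-oo, x]%classic.

(* Main.v *)
From HB Require Import structures.
Require Import Defs.
From mathcomp Require Import zify ring lra measurable_realfun.

(** Let N be the number of pairs of vertices and X the number of Hamilton
cycles.  Once the number of edges is fixed, X is concentrated around its mean;
in the binomial graph it therefore fluctuates only through the number of edges,
and that number obeys a central limit theorem.

Concentration.  In G(n,m) the quotient E X^2 / (E X)^2 is the average, over
pairs of Hamilton cycles C, C', of a quotient of falling factorials that
depends only on b = |C :&: C'|.  With t = (N - m) / (m - 2n) this quotient is at
most exp(- n^2 (N - m) / (N m)) (1 + t)^b ([ffact_ratio_double],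
[ffact_ratio_backwards]).  For a random pair, b behaves like a Poisson variable
of mean 2, and the average of (1 + t)^b is at most e^(2t) up to a factor
1 + O((t^2 + t) / n) ([sum_pow_overlap_le]).  As n^2 / N is close to 2, the two
exponentials cancel and E X^2 / (E X)^2 = 1 + O(n^3 / m^2)
([gnm_second_moment]).  The condition p >> n^(-1/2) says precisely that
n^3 / m^2 tends to 0, so Chebyshev's inequality gives the first claim, with a
bound that is uniform in m.  The estimate on b is a count: at most
2^k n (n - k - 1)! of the n! enumerations of the vertices trace a cycle through
k given edges ([card_cycle_containing]).

Fluctuations.  Let M be the number of edges of G(n,p), xi its standardisation,
and mu_k the mean of X in G(n,k).  Expanding the logarithms of the falling
factorials gives ln (mu_M / lambda) = beta xi - beta^2 / 2 + o(1) when xi is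
bounded ([ln_mean_ratio]).  By concentration X may replace mu_M here, so
ln (e^(beta^2 / 2) X / lambda) / beta is close to xi outside an event of small
probability ([lnZ_cdf_sandwich]).

The central limit theorem for M ([de_moivre_laplace]) is elementary because the
mean pN is the integer m: multiplying the ratios of consecutive binomial
probabilities, starting from m, shows that the probability of k is proportional
to the Gaussian mass of the cell of length 1/s at (k - m) / s, where s is the
standard deviation.  The constant of proportionality, which Stirling's formula
would give, is found by summing over a wide window: it carries almost the whole
mass of both distributions. *)

Set Implicit Arguments.
Unset Strict Implicit.
Unset Printing Implicit Defensive.

Local Open Scope ring_scope.

(** * Counting enumerations with prescribed successors *)

Section ConstrainedSequences.
Import mathcomp.boot.seq mathcomp.boot.fintype mathcomp.boot.finset.
Local Open Scope nat_scope.

(** In a sequence that traces the steps of [D], a source is followed by its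
target and a target is preceded by its source; the second clause is what makes
the entries that are not targets determine the others. *)
Definition linked (T : finType) (D : {set T * T}) : rel T :=
  [rel a b | [forall v, ((a, v) \in D) ==> (v == b)] &&
             [forall u, ((u, b) \in D) ==> (u == a)]].

(** The sequence can be rebuilt from left to right: after a source the next entry
is forced, and after any other entry comes a vertex that is not a target, hence
the next entry of the filtered sequence. *)
Lemma filter_path_inj (T : finType) (D : {set T * T}) (x : T) (s s' : seq T) :
  let keep := fun v => v \notin [set d.2 | d in D] in
  path (linked D) x s -> path (linked D) x s' -> size s = size s' ->
  filter keep s = filter keep s' -> s = s'.
Proof.
move=> keep.
have keepN a b : linked D a b -> (forall v, (a, v) \notin D) -> keep b.
  move=> /andP[_ /forallP Rab] aD; apply/negP => /imsetP[[u v] uvD /= bv].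
  have := Rab u; rewrite bv uvD => /eqP ua.
  by move: (aD v); rewrite -ua uvD.
elim: s s' x => [|b s IHs] [|b' s'] x //= /andP[Rb ps] /andP[Rb' ps'] [sz].
have [/existsP[v xvD]|/existsPn xD] := boolP [exists v, (x, v) \in D].
  case/andP: (Rb) => /forallP /(_ v); rewrite xvD => /eqP vb _.
  case/andP: (Rb') => /forallP /(_ v); rewrite xvD => /eqP vb' _.
  subst v b'; case: ifP => _ => [[]|] ff; congr (_ :: _); exact: (IHs _ b).
rewrite !(keepN x) // => -[? ff]; subst b'; congr (_ :: _); exact: (IHs _ b).
Qed.

Lemma next_path (T : finType) (D : {set T * T}) (x : T) (s : seq T) :
  uniq (x :: s) -> (forall v, v \in x :: s) ->
  (forall d, d \in D -> next (x :: s) d.1 = d.2) ->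
  path (linked D) x s.
Proof.
move=> us sT nD; apply/(pathP x) => i ilt.
set a := nth _ _ _; set b := nth _ _ _.
have nab : next (x :: s) a = b.
  have ilt' : i < size (x :: s) by rewrite /= leqW.
  by rewrite next_nth mem_nth // index_uniq.
apply/andP; split; apply/forallP => v; apply/implyP => vD.
  by rewrite -nab (nD _ vD).
apply/eqP; apply: (can_inj (prev_next us)).
by rewrite nab (nD _ vD).
Qed.

(** The [n - #|D|] vertices that are not targets determine the rest.  Rotating to
start at one of them, [x], leaves [n] choices for the position of [x] and at
most [(n - #|D| - 1)!] orders for the others. *)
Lemma card_next_constraint (T : finType) (n : nat) (D : {set T * T}) :
  #|T| = n -> #|D| < n ->
  #|[set s : n.-tuple T | uniq s && [forall d in D, next s d.1 == d.2]]|
    <= n * (n - #|D| - 1)`!.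
Proof.
move=> cT Dn; set A := [set _ | _].
have [->|/set0Pn[s0]] := eqVneq A set0; first by rewrite cards0.
rewrite inE => /andP[us0 /forall_inP nD0].
set W := [set d.2 | d in D].
have snd_inj : {in D &, injective (fun d : T * T => d.2)}.
  move=> [u v] [u' v'] uvD uvD' /= e; subst v'; congr (_, _).
  apply: (can_inj (prev_next us0)).
  by rewrite (eqP (nD0 _ uvD)) (eqP (nD0 _ uvD')).
have cW : #|W| = #|D| by rewrite card_in_imset.
(* As [n - #|D| > 0], some vertex is not a target; the sequences are rotated to
   start there, so that no constraint wraps around the end. *)
have [x xW] : exists x, x \notin W.
  apply/existsP; rewrite -negb_forall; apply/negP => /forallP allW.
  suff : #|T| <= #|W| by rewrite cT cW leqNgt Dn.
  by apply: subset_leq_card; apply/subsetP => y _.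
have full (s : n.-tuple T) : uniq s -> forall y, y \in s.
  move=> us y; have : [set z in s] == [set: T].
    by rewrite eqEcard subsetT cardsT cT cardsE (card_uniqP us) size_tuple /=.
  by move/eqP/setP/(_ y); rewrite !inE.
pose keep := fun v => v \notin W.
pose k := n - #|D| - 1.
have cA : #|~: (x |: W)| = k.
  by rewrite cardsCs setCK cardsU1 xW cW cT addnC subnDA.
pose tl (s : n.-tuple T) := filter keep (behead (rot (index x s) s)).
have n0 : 0 < n by apply: leq_ltn_trans Dn.
pose f (s : n.-tuple T) : 'I_n * k.-tuple T :=
  (insubd (Ordinal n0) (index x s), insubd (nseq_tuple k x) (tl s)).
have rotE (s : n.-tuple T) : uniq s ->
    rot (index x s) s = x :: behead (rot (index x s) s).
  move=> us; have xs := full s us x.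
  by rewrite /rot (drop_nth x) ?index_mem // nth_index.
have tlP (s : n.-tuple T) : uniq s ->
    [/\ size (tl s) = k, uniq (tl s) & {subset tl s <= ~: (x |: W)}].
  move=> us; have := rotE _ us; set r := behead _ => rE.
  have ur : uniq (x :: r) by rewrite -rE rot_uniq.
  have rT y : y \in x :: r by rewrite -rE mem_rot full.
  have utl : uniq (tl s) by rewrite filter_uniq //; case/andP: ur.
  have tlE : tl s =i ~: (x |: W).
    move=> y; rewrite /tl mem_filter /keep !inE negb_or andbC -/r.
    have := rT y; rewrite inE; case: eqVneq => [->|] /=; last by move=> _ ->.
    by case/andP: ur => /negbTE ->.
  split=> //; last by move=> y; rewrite tlE.
  by rewrite -(card_uniqP utl) (eq_card tlE).
have finj : {in A &, injective f}.
  move=> s s' /[!inE] /andP[us /forall_inP nD] /andP[us' /forall_inP nD'].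
  have [sz _ _] := tlP _ us; have [sz' _ _] := tlP _ us'.
  have xs := full s us x; have xs' := full s' us' x.
  have ilt (t : n.-tuple T) : x \in t -> index x t < n.
    by rewrite -index_mem size_tuple.
  case=> /(congr1 val); rewrite !val_insubd /= !ilt // => ie.
  move=> /(congr1 val); rewrite !val_insubd /= sz sz' eqxx => te.
  have nxt (t : n.-tuple T) : uniq t -> (forall d, d \in D -> next t d.1 == d.2) ->
      path (linked D) x (behead (rot (index x t) t)).
    move=> ut tD; apply: next_path; rewrite -?rotE ?rot_uniq //.
      by move=> v; rewrite mem_rot full.
    by move=> d dD; rewrite next_rot //; apply/eqP/tD.
  have := filter_path_inj (nxt s us nD) (nxt s' us' nD').
  rewrite !size_behead !size_rot !size_tuple => /(_ erefl te) be.
  apply: val_inj; apply: (@rot_inj (index x s)).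
  have rE : rot (index x s) s = rot (index x s') s'.
    by rewrite (rotE s) // (rotE s') // be.
  by rewrite rE ie.
rewrite -(card_in_imset finj).
apply: (@leq_trans #|setX [set: 'I_n]
   [set t : k.-tuple T | all [in ~: (x |: W)] t & uniq t]|).
  apply: subset_leq_card; apply/subsetP => _ /imsetP[s sA ->].
  move: sA; rewrite inE => /andP[us _]; have [sz utl sub] := tlP _ us.
  rewrite !inE /= !val_insubd /= sz eqxx utl andbT.
  by apply/allP => y /sub.
rewrite cardsX cardsT card_ord card_uniq_tuples.
by rewrite (eq_card (B := ~: (x |: W))) ?cA ?ffactnn.
Qed.

End ConstrainedSequences.

(** * Hamilton cycles as images of enumerations *)

Section HamiltonCycles.
Import mathcomp.boot.seq mathcomp.boot.fintype mathcomp.boot.finset.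
Local Open Scope nat_scope.
Variable n : nat.

Definition cycle_edges (s : n.-tuple 'I_n) : graph n :=
  [set e : edge n | val e \in [set [set x; next s x] | x : 'I_n]].

(** Each of the [#|S|] edges is traversed in one of two directions, and every
choice of directions is a constraint on successors. *)
Lemma card_cycle_containing (S : graph n) : #|S| < n ->
  #|[set s : n.-tuple 'I_n | uniq s && (S \subset cycle_edges s)]|
    <= 2 ^ #|S| * (n * (n - #|S| - 1)`!).
Proof.
move=> Sn.
have /fin_all_exists[g gE] : forall e : edge n, exists d : 'I_n * 'I_n,
    val e = [set d.1; d.2] /\ d.1 != d.2.
  by move=> e; have /cards2P[x [y [xy eE]]] := valP e; exists (x, y); split; first exact: eE.
pose D (B : {set edge n}) := [set (if e \in B then g e else ((g e).2, (g e).1)) | e in S].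
have cD B : #|D B| = #|S|.
  rewrite card_in_imset // => e e' _ _ h; apply: val_inj; rewrite (gE e).1 (gE e').1.
  have [] : ((g e).1 = (g e').1 /\ (g e).2 = (g e').2) \/
            ((g e).1 = (g e').2 /\ (g e).2 = (g e').1).
    by move: h; case: ifP => _; case: ifP => _; case: (g e) => ? ?;
       case: (g e') => ? ? [] -> -> /=; auto.
    by case=> -> ->.
  by case=> -> ->; rewrite setUC.
pose P B := [set s : n.-tuple 'I_n | uniq s && [forall d in D B, next s d.1 == d.2]].
have cP B : #|P B| <= n * (n - #|S| - 1)`!.
  by rewrite -(cD B); apply: card_next_constraint; rewrite ?card_ord ?cD.
apply: (@leq_trans #|\bigcup_(B in powerset S) P B|).
  apply: subset_leq_card; apply/subsetP => s /[!inE] /andP[us /subsetP sS].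
  apply/bigcupP; exists [set e in S | next s (g e).1 == (g e).2].
    by rewrite inE; apply/subsetP => e /[!inE] /andP[].
  (* [B] collects the edges that [s] traverses from their first end to the second. *)
  rewrite inE us; apply/forall_inP => d /imsetP[e eS ->].
  rewrite inE eS /=; case: ifP => // /negP ne /=.
  have := sS _ eS; rewrite inE (gE e).1 => /imsetP[x _ xE].
  have /set2P g1 : (g e).1 \in [set x; next s x] by rewrite -xE set21.
  have /set2P g2 : (g e).2 \in [set x; next s x] by rewrite -xE set22.
  have := (gE e).2; case: g1 g2 ne => [->|->] [->|->]; rewrite eqxx //.
apply: (@leq_trans (\sum_(B in powerset S) #|P B|)).
  elim/big_rec2: _ => [|B a b _ ab]; first by rewrite cards0.
  by rewrite (leq_trans (leq_card_setU _ _)) // leq_add2l.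
rewrite -card_powerset -sum_nat_const.
by apply: leq_sum => B _.
Qed.

Lemma uniq_full (s : n.-tuple 'I_n) : uniq s -> forall y, y \in s.
Proof.
move=> us y; have : [set z in s] == [set: 'I_n].
  by rewrite eqEcard subsetT cardsT card_ord cardsE (card_uniqP us) size_tuple /=.
by move/eqP/setP/(_ y); rewrite !inE.
Qed.

(** This is where a cycle needs three vertices: with two, both edges at a vertex
would coincide. *)
Lemma next_iter2_neq (T : eqType) (s : seq T) x : uniq s -> 2 < size s ->
  x \in s -> (next s x != x) && (next s (next s x) != x).
Proof.
move=> us s2 xs; have [i s' sE] := rot_to xs.
have us' : uniq (x :: s') by rewrite -sE rot_uniq.
have e y : next s y = next (x :: s') y by rewrite -sE next_rot.
have : 2 < size (x :: s') by rewrite -sE size_rot.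
rewrite !e; case: s' us' {sE e} => [|y [|z s']] //= /and3P[xyz yz _] _.
move: xyz yz; rewrite !inE !negb_or => /and3P[xy xz _] /andP[yz _].
by rewrite !eqxx !(eq_sym _ x) (negbTE xy) xz.
Qed.

Lemma imset_cycle_edges (s : n.-tuple 'I_n) : 2 < n -> uniq s ->
  [set val e | e in cycle_edges s] = [set [set x; next s x] | x : 'I_n].
Proof.
move=> n2 us; apply/setP => A; apply/imsetP/idP => [[e /[!inE] + ->] //|AF].
have c2 : #|A| == 2.
  case/imsetP: AF => x _ ->; rewrite cards2 (eq_sym x).
  by have /andP[->] : _ := next_iter2_neq us (eq_ind_r (leq 3) n2 (size_tuple s)) (uniq_full us x).
by exists (Sub A c2 : edge n); rewrite // inE.
Qed.

Lemma hamilton_cycleP (C : graph n) : 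
  reflect (2 < n /\ exists2 s : n.-tuple 'I_n, uniq s & C = cycle_edges s)
          (hamilton_cycle C).
Proof.
apply: (iffP andP) => -[n2 h]; split=> //.
  case/existsP: h => s /andP[us /eqP h]; exists s => //.
  apply/setP => e; rewrite inE -h; apply/idP/imsetP => [eC|[e' e'C /val_inj->//]].
  by exists e.
case: h => s us ->; apply/existsP; exists s; rewrite us.
by apply/eqP; exact: imset_cycle_edges.
Qed.

Hypothesis n2 : 2 < n.
Local Notation HC := [set C : graph n | hamilton_cycle C].

Lemma card_cycle_edges (s : n.-tuple 'I_n) : uniq s -> #|cycle_edges s| = n.
Proof.
move=> us; have nP x : (next s x != x) && (next s (next s x) != x).
  by rewrite next_iter2_neq ?size_tuple ?uniq_full.
rewrite -[RHS](card_ord n).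
rewrite -(card_imset (cycle_edges s) val_inj).
rewrite imset_cycle_edges //.
rewrite card_imset // => x y /setP xy.
have /set2P[//|xE] : x \in [set y; next s y] by rewrite -xy set21.
have /set2P[//|yE] : y \in [set x; next s x] by rewrite xy set21.
by have := nP x; rewrite -yE -xE eqxx andbF.
Qed.

Lemma card_hamilton_cycle (C : graph n) : C \in HC -> #|C| = n.
Proof.
by rewrite inE => /hamilton_cycleP[_ [s us ->]]; exact: card_cycle_edges.
Qed.

Lemma hamilton_cycles_gt0 : 0 < #|HC|.
Proof.
apply/card_gt0P; exists (cycle_edges (ord_tuple n)); rewrite inE.
by apply/hamilton_cycleP; split=> //; exists (ord_tuple n); rewrite //= enum_uniq.
Qed.

(** Relabelling the vertices by the permutation that takes [s] to [t] maps
enumerations of the first cycle to enumerations of the second; by symmetry all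
Hamilton cycles have the same number of enumerations. *)
Lemma leq_card_same_cycle (s t : n.-tuple 'I_n) : uniq s -> uniq t ->
  #|[set u : n.-tuple 'I_n | uniq u && (cycle_edges u == cycle_edges s)]|
  <= #|[set u : n.-tuple 'I_n | uniq u && (cycle_edges u == cycle_edges t)]|.
Proof.
move=> us ut; have n0 : 0 < n by apply: leq_trans n2.
pose g x := nth (Ordinal n0) t (index x s).
have sx x : index x s < n by rewrite -[X in _ < X](size_tuple s) index_mem uniq_full.
have g_inj : injective g.
  move=> x y /eqP; rewrite nth_uniq ?size_tuple // => /eqP.
  by move/(congr1 (nth x s)); rewrite !nth_index ?uniq_full.
have tE : t = map_tuple g s.
  apply: eq_from_tnth => i; rewrite tnth_map /g !(tnth_nth (Ordinal n0)).
  by rewrite index_uniq ?size_tuple.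
have edgesE (u : n.-tuple 'I_n) : uniq u -> 
    [set [set x; next (map_tuple g u) x] | x : 'I_n] =
    [set g @: (A : {set 'I_n}) | A in [set [set x; next u x] | x : 'I_n]].
  move=> uu; rewrite -imset_comp /=.
  have e x : [set g x; next (map_tuple g u) (g x)] = g @: [set x; next u x].
    by rewrite next_map // imsetU1 imset_set1.
  apply/setP => A; apply/imsetP/imsetP => -[x _ ->]; last by exists (g x).
  have [h _ hK] := injF_bij g_inj; exists (h x) => //=.
  by rewrite -e hK.
have cE (u v : n.-tuple 'I_n) : uniq u -> uniq v -> 
    cycle_edges u = cycle_edges v -> 
    [set [set x; next u x] | x : 'I_n] = [set [set x; next v x] | x : 'I_n].
  by move=> uu uv; rewrite -!imset_cycle_edges // => ->.
rewrite -(card_imset _ (f := map_tuple g)); last first.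
  by move=> u v /(congr1 val) /= /(inj_map g_inj) /val_inj.
apply: subset_leq_card; apply/subsetP => _ /imsetP[u /[!inE] /andP[uu /eqP ue] ->].
rewrite map_inj_uniq // uu; apply/eqP/setP => e; rewrite !inE tE !edgesE //.
by rewrite (cE _ _ uu us ue).
Qed.

(** All fibres of [cycle_edges] have the same size, so a uniform enumeration traces
a uniform Hamilton cycle. *)
Lemma card_hamilton_supset (S : graph n) :
  #|[set C in HC | S \subset C]| * n`! =
  #|HC| * #|[set s : n.-tuple 'I_n | uniq s && (S \subset cycle_edges s)]|.
Proof.
pose F C := [set s : n.-tuple 'I_n | uniq s && (cycle_edges s == C)].
have [C0 C0H] := card_gt0P hamilton_cycles_gt0.
have FE C : C \in HC -> #|F C| = #|F C0|.
  move: C0H; rewrite !inE => /hamilton_cycleP[_ [s us ->]] /hamilton_cycleP[_ [t ut ->]].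
  by apply/eqP; rewrite eqn_leq !leq_card_same_cycle.
have key (S' : graph n) : #|[set s : n.-tuple 'I_n | uniq s && (S' \subset cycle_edges s)]| =
     #|[set C in HC | S' \subset C]| * #|F C0|.
  rewrite -sum1_card (partition_big cycle_edges [in [set C in HC | S' \subset C]]) /=; last first.
    move=> s /[!inE] /andP[us ->]; rewrite andbT.
    by apply/hamilton_cycleP; split=> //; exists s.
  rewrite -sum_nat_const; apply: eq_bigr => C /[!inE] /andP[CH SC].
  rewrite -(FE C) ?inE // -sum1_card; apply: eq_bigl => s; rewrite !inE.
  by case: eqP => [->|]; rewrite ?andbF // SC !andbT.
have n1 : n`! = #|HC| * #|F C0|.
  transitivity #|[set s : n.-tuple 'I_n | all predT s & uniq s]|.
    by rewrite card_uniq_tuples card_ord ffactnn.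
  transitivity (#|[set C in HC | set0 \subset C]| * #|F C0|).
    by rewrite -key; apply: eq_card => s; rewrite !inE sub0set andbT all_predT.
  by congr (_ * _); apply: eq_card => C; rewrite !inE sub0set andbT.
by rewrite key n1 mulnCA.
Qed.

End HamiltonCycles.

(** * The overlap of two Hamilton cycles *)

Section Overlap.
Import mathcomp.boot.seq mathcomp.boot.fintype mathcomp.boot.finset.
Local Open Scope nat_scope.
Variable n : nat.
Hypothesis n2 : 2 < n.
Local Notation HC := [set C : graph n | hamilton_cycle C].

Lemma hamilton_supset_le (S : graph n) : #|S| < n ->
  #|[set C in HC | S \subset C]| * n`! <= #|HC| * (2 ^ #|S| * (n * (n - #|S| - 1)`!)).
Proof.
by move=> Sn; rewrite card_hamilton_supset // leq_mul2l card_cycle_containing ?orbT.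
Qed.

(** Both sides count pairs of a Hamilton cycle [C'] and a [k]-subset of
[C :&: C']. *)
Lemma sum_bin_overlap (C : graph n) k :
  \sum_(C' in HC) 'C(#|C :&: C'|, k) =
  \sum_(S : graph n | (S \subset C) && (#|S| == k)) #|[set C' in HC | S \subset C']|.
Proof.
under eq_bigr do rewrite -cards_draws -sum1_card.
under [RHS]eq_bigr do rewrite -sum1_card.
rewrite (exchange_big_dep (fun S : graph n => (S \subset C) && (#|S| == k))) /=; last first.
  by move=> C' S _ /[!inE]; rewrite subsetI => /andP[/andP[-> _] ->].
apply: eq_bigr => S /andP[SC Sk]; apply: eq_bigl => C'.
by rewrite !inE subsetI SC Sk andbT.
Qed.

(** A binomial moment of the overlap: up to the factor
[n / maxn 1 (n - k)] it is at most the moment [2 ^ k / k!] of a Poisson variable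
of mean 2.  For [k = n] the counting bound is not available and is replaced by
the one for [n - 1] edges. *)
Lemma sum_bin_overlap_le (C : graph n) k : C \in HC -> k <= n ->
  (\sum_(C' in HC) 'C(#|C :&: C'|, k)) * (k`! * maxn 1 (n - k)) <= #|HC| * 2 ^ k * n.
Proof.
move=> CH; have cC := card_hamilton_cycle n2 CH.
rewrite sum_bin_overlap leq_eqVlt => /predU1P[->|kn].
  rewrite subnn /= muln1 (eq_bigl (pred1 C)); last first.
    move=> S /=; rewrite eqEcard cC; case: (boolP (S \subset C)) => //= SC.
    by have := subset_leq_card SC; rewrite cC eqn_leq => ->.
  rewrite big_pred1_eq.
  have [e eC] : exists e, e \in C by apply/card_gt0P; rewrite cC; lia.
  have cS : #|C :\ e| = n.-1 by have := cardsD1 e C; rewrite eC cC add1n => /(congr1 predn).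
  apply: (@leq_trans (#|[set C' in HC | C :\ e \subset C']| * n`!)).
    rewrite leq_mul2r subset_leq_card ?orbT //; apply/subsetP => C' /[!inE] /andP[->].
    by apply: subset_trans; exact: subD1set.
  apply: leq_trans (hamilton_supset_le _) _; first by rewrite cS; lia.
  rewrite cS (_ : n - n.-1 - 1 = 0) ?muln1; last by lia.
  by rewrite mulnA leq_mul2r leq_mul2l leq_exp2l // leq_pred !orbT.
rewrite -(leq_pmul2r (fact_gt0 n)) -(leq_pmul2r (fact_gt0 (n - k - 1))).
set s := \sum_(_ | _) _.
have : s * n`! <= 'C(n, k) * (#|HC| * (2 ^ k * (n * (n - k - 1)`!))).
  have -> : 'C(n, k) = 'C(#|C|, k) by rewrite cC.
  rewrite /s big_distrl /= -cards_draws -sum_nat_const.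
  rewrite [leqRHS](eq_bigl (fun S : graph n => (S \subset C) && (#|S| == k))); last first.
    by move=> S; rewrite inE.
  apply: leq_sum => S /andP[_ /eqP Sk].
  by have := @hamilton_supset_le S; rewrite Sk; apply.
have := bin_fact (ltnW kn).
have -> : (n - k)`! = (n - k) * (n - k - 1)`!.
  by rewrite -{1}(subnK (_ : 1 <= n - k)) ?addn1 ?factS ?subn_gt0 // subn1 prednK ?subn_gt0.
rewrite (maxn_idPr _) ?subn_gt0 // => be le.
set f := (n - k - 1)`! in be le *.
have -> : s * (k`! * (n - k)) * n`! * f = (s * n`!) * (k`! * ((n - k) * f)) by ring.
apply: leq_trans (leq_mul le (leqnn _)) _.
by rewrite -be; apply: eq_leq; ring.
Qed.

(** The correction factor [n / maxn 1 (n - k)] is at most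
[1 + 4 k^2 / n], with [k^2] written in falling factorials so that it can be
summed against [x^k / k!]. *)
Lemma overlap_factor_le k : k <= n -> n * n <= (n + 4 * (k ^_ 2 + k)) * maxn 1 (n - k).
Proof.
case: k => [|k] kn; first by rewrite /= subn0 (maxn_idPr _) ?addn0; lia.
have -> : k.+1 ^_ 2 + k.+1 = k.+1 * k.+1 by rewrite ffactnS ffactn1 /=; lia.
case: (leqP n k.+1) => h; first by (have -> : n = k.+1 by lia); nia.
rewrite (maxn_idPr _) ?subn_gt0 //; have [d ->] : exists d, n = k.+1 + d.+1.
  by exists (n - k.+2); lia.
rewrite addKn; nia.
Qed.

End Overlap.

Section ExponentialSums.
Variable R : realType.

Lemma sum_ffact_exp_le (x : R) (j N : nat) : 0 <= x ->
  \sum_(k < N) (k ^_ j)%:R * (x ^+ k / k`!%:R) <= x ^+ j * expR x.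
Proof.
move=> x0; elim: j N => [|j IHj] N.
  rewrite expr0 mul1r; under eq_bigr do rewrite ffactn0 mul1r.
  have -> : \sum_(k < N) x ^+ k / k`!%:R = series (exp_coeff x) N :> R.
    by rewrite /series /= big_mkord.
  apply: nondecreasing_cvgn_le; last exact: is_cvg_series_exp_coeff.
  by apply: nondecreasing_series => i _ _; exact: exp_coeff_ge0.
case: N => [|N]; first by rewrite big_ord0 mulr_ge0 ?exprn_ge0 ?expR_ge0.
rewrite big_ord_recl ffact0n mul0r add0r exprS -mulrA.
apply: le_trans (ler_wpM2l x0 (IHj N)); rewrite mulr_sumr.
apply: ler_sum => k _; rewrite /= /bump /= add1n ffactSS factS exprS !natrM.
have : k`!%:R != 0 :> R by rewrite pnatr_eq0 -lt0n fact_gt0.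
have : k.+1%:R != 0 :> R by rewrite pnatr_eq0.
move: (k.+1%:R) (k`!%:R) => a b a0 b0.
by rewrite le_eqVlt; apply/orP; left; apply/eqP; field; rewrite a0 b0.
Qed.

(** Expanding [(1 + t) ^+ b] in binomial coefficients reduces the bound to the
binomial moments of the overlap; the main term is the generating function
[expR (2 * t)] of a Poisson variable of mean 2. *)
Lemma sum_pow_overlap_le (n : nat) (C : graph n) (t : R) : (2 < n)%N -> 
  hamilton_cycle C -> 0 <= t ->
  \sum_(C' : graph n | hamilton_cycle C') (1 + t) ^+ #|C :&: C'| <=
  #|[set C : graph n | hamilton_cycle C]|%:R *
    (expR (2 * t) * (1 + 4 * (4 * t ^+ 2 + 2 * t) / n%:R)).
Proof.
move=> n2 HC t0; set h := #|_|%:R.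
have n0 : 0 < n%:R :> R by rewrite ltr0n; lia.
have CH : C \in [set C : graph n | hamilton_cycle C] by rewrite inE.
have cC := card_hamilton_cycle n2 CH.
have -> : \sum_(C' : graph n | hamilton_cycle C') (1 + t) ^+ #|C :&: C'| =
   \sum_(k < n.+1) t ^+ k *
     (\sum_(C' in [set C : graph n | hamilton_cycle C]) 'C(#|C :&: C'|, k))%:R.
  under [RHS]eq_bigr do rewrite natr_sum mulr_sumr.
  rewrite exchange_big /=; apply: eq_big => C'; first by rewrite inE.
  move=> _; rewrite exprDn.
  have lebn : (#|C :&: C'| <= n)%N by have := subset_leq_card (subsetIl C C'); rewrite cC.
  rewrite (big_ord_widen n.+1 (fun i => 1 ^+ (#|C :&: C'| - i) * t ^+ i *+ 'C(#|C :&: C'|, i))) //.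
  rewrite big_mkcond /=; apply: eq_bigr => i _; rewrite expr1n mul1r mulr_natr ltnS.
  by case: leqP => // /bin_small ->.
apply: (@le_trans _ _ (\sum_(k < n.+1) h * (((2 * t) ^+ k / k`!%:R) *
    (1 + 4 * ((k ^_ 2)%:R + (k ^_ 1)%:R) / n%:R)))).
  apply: ler_sum => k _; have kn : (k <= n)%N by rewrite -ltnS.
  have := sum_bin_overlap_le n2 CH kn; set s := (\sum_(_ in _) _)%N => sle.
  have := overlap_factor_le n2 kn; set M := maxn _ _ in sle * => Mle.
  have M0 : 0 < M%:R :> R by rewrite ltr0n /M; lia.
  have f0 : 0 < k`!%:R :> R by rewrite ltr0n fact_gt0.
  have {}sle : s%:R <= h * 2 ^+ k * n%:R / (k`!%:R * M%:R) :> R.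
    by rewrite ler_pdivlMr ?mulr_gt0 // /h -natrX -!natrM ler_nat.
  have {}Mle : n%:R / M%:R <= 1 + 4 * ((k ^_ 2)%:R + (k ^_ 1)%:R) / n%:R :> R.
    rewrite ler_pdivrMr // -(ler_pM2r n0) mulrAC mulrDl mul1r divfK ?gt_eqF //.
    by rewrite -natrD -natrM -natrD -!natrM ler_nat ffactn1.
  apply: le_trans (ler_wpM2l (exprn_ge0 _ t0) sle) _.
  have -> : t ^+ k * (h * 2 ^+ k * n%:R / (k`!%:R * M%:R)) =
     h * ((2 * t) ^+ k / k`!%:R * (n%:R / M%:R)) by rewrite exprMn; field; rewrite !gt_eqF.
  by rewrite ler_wpM2l // ler_wpM2l // divr_ge0 // exprn_ge0 // mulr_ge0.
rewrite -mulr_sumr ler_wpM2l //.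
have t20 : 0 <= 2 * t by rewrite mulr_ge0.
have S0 := sum_ffact_exp_le 0 n.+1 t20; have S1 := sum_ffact_exp_le 1 n.+1 t20.
have S2 := sum_ffact_exp_le 2 n.+1 t20.
have -> : \sum_(k < n.+1) (2 * t) ^+ k / k`!%:R * (1 + 4 * ((k ^_ 2)%:R + (k ^_ 1)%:R) / n%:R) =
  \sum_(k < n.+1) (k ^_ 0)%:R * ((2 * t) ^+ k / k`!%:R) +
  4 / n%:R * (\sum_(k < n.+1) (k ^_ 2)%:R * ((2 * t) ^+ k / k`!%:R) +
    \sum_(k < n.+1) (k ^_ 1)%:R * ((2 * t) ^+ k / k`!%:R)).
  rewrite -big_split /= mulr_sumr -big_split /=; apply: eq_bigr => k _.
  by rewrite ffactn0 ; ring.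
apply: le_trans (lerD S0 (ler_wpM2l _ (lerD S2 S1))) _; first by rewrite divr_ge0.
by rewrite le_eqVlt; apply/orP; left; apply/eqP; field; rewrite gt_eqF.
Qed.

End ExponentialSums.

(** * Moments of the number of Hamilton cycles *)

Section Moments.
Import mathcomp.boot.seq mathcomp.boot.fintype mathcomp.boot.finset.
Variable R : realType.

Lemma chebyshev_relative (T : finType) (w X : T -> R) (d eps : R) :
  (forall x, 0 <= w x) -> \sum_x w x = 1 -> 0 < Ex w X -> 0 < eps ->
  Ex w (fun x => X x ^+ 2) <= Ex w X ^+ 2 * (1 + d) ->
  Pr w (fun x => eps < `|X x / Ex w X - 1|) <= d / eps ^+ 2.
Proof.
move=> w0 w1 mu0 eps0 le2; rewrite ler_pdivlMr ?exprn_gt0 //.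
set mu := Ex w X in mu0 le2 *.
apply: (@le_trans _ _ (\sum_x w x * (X x / mu - 1) ^+ 2)).
  rewrite /Pr mulr_suml [leRHS](bigID (fun x => eps < `|X x / mu - 1|)) /=.
  rewrite ler_wpDr //; first by apply: sumr_ge0 => x _; rewrite mulr_ge0 ?sqr_ge0.
  apply: ler_sum => x h; rewrite ler_wpM2l //.
  by rewrite -[leRHS]real_normK ?num_real // ler_sqr ?nnegrE ?normr_ge0 // ltW.
have -> : \sum_x w x * (X x / mu - 1) ^+ 2 =
    Ex w (fun x => X x ^+ 2) / mu ^+ 2 - 2 * (mu / mu) + 1.
  have -> : mu / mu = \sum_x w x * X x / mu by rewrite -mulr_suml.
  rewrite -[X in _ = _ + X]w1 /Ex mulr_suml mulr_sumr -sumrB -big_split /=.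
  by apply: eq_bigr => x _; field; rewrite gt_eqF.
have : Ex w (fun x => X x ^+ 2) / mu ^+ 2 <= 1 + d.
  by rewrite ler_pdivrMr ?exprn_gt0 // mulrC.
rewrite divff ?gt_eqF //; lra.
Qed.

(** Both models of random graph are exchangeable, so only the probability [f k] of
containing [k] given edges matters. *)
Section SubgraphProbabilities.
Variables (n : nat) (w : graph n -> R) (f : nat -> R).
Hypothesis wP : forall S : graph n, Pr w (fun G => S \subset G) = f #|S|.
Local Notation HC := [set C : graph n | hamilton_cycle C].
Local Notation X := (fun G : graph n => (num_hamilton_cycles G)%:R : R).

Lemma num_hamilton_cyclesE (G : graph n) :
  X G = \sum_(C : graph n | hamilton_cycle C) (C \subset G)%:R.
Proof.
rewrite /num_hamilton_cycles -sum1_card natr_sum big_mkcond [RHS]big_mkcond /=.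
by apply: eq_bigr => C _; rewrite inE; case: hamilton_cycle => //=; case: (C \subset G).
Qed.

Lemma Ex_subset (S : graph n) : Ex w (fun G => (S \subset G)%:R) = f #|S|.
Proof.
rewrite -wP /Ex /Pr [RHS]big_mkcond /=; apply: eq_bigr => G _.
by case: (S \subset G); rewrite ?mulr1 ?mulr0.
Qed.

Lemma Ex_num_hamilton_cycles : (2 < n)%N -> Ex w X = #|HC|%:R * f n.
Proof.
move=> n2; rewrite /Ex; under eq_bigr do rewrite num_hamilton_cyclesE mulr_sumr.
rewrite exchange_big /= -sum1_card natr_sum mulr_suml big_set.
apply: eq_bigr => C HC'; rewrite -/(Ex w _) Ex_subset mul1r.
by rewrite card_hamilton_cycle // inE.
Qed.

Lemma Ex_num_hamilton_cycles_sqr : (2 < n)%N -> Ex w (fun G => X G ^+ 2) =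
  \sum_(C : graph n | hamilton_cycle C) \sum_(C' : graph n | hamilton_cycle C')
    f (2 * n - #|C :&: C'|)%N.
Proof.
move=> n2; rewrite /Ex.
under eq_bigr do rewrite num_hamilton_cyclesE expr2 big_distrlr mulr_sumr.
rewrite exchange_big /=; apply: eq_bigr => C HC1.
under eq_bigr do rewrite mulr_sumr.
rewrite exchange_big /=; apply: eq_bigr => C' HC2.
have -> : (2 * n - #|C :&: C'|)%N = #|C :|: C'|.
  rewrite cardsU (card_hamilton_cycle n2 (C := C)) ?inE //.
  by rewrite (card_hamilton_cycle n2 (C := C')) ?inE // addnn mul2n.
rewrite -Ex_subset; apply: eq_bigr => G _.
by rewrite subUset -natrM mulnb.
Qed.

End SubgraphProbabilities.

(** The [m]-sets containing [S] correspond to the [(m - #|S|)]-subsets of its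
complement. *)
Lemma card_supset_draws (T : finType) (S : {set T}) m :
  (#|[set G : {set T} | (S \subset G) && (#|G| == m)]| * #|T| ^_ #|S| =
    'C(#|T|, m) * m ^_ #|S|)%N.
Proof.
set k := #|S|; set A := [set G | _].
have [mk|km] := ltnP m k.
  rewrite (ffact_small mk) muln0 (_ : A = set0) ?cards0 //; apply/setP => G.
  rewrite !inE; apply/negP => /andP[/subset_leq_card + /eqP Gm].
  by rewrite Gm leqNgt mk.
have [Tm|mT] := ltnP #|T| m.
  rewrite (bin_small Tm) (_ : A = set0) ?cards0 //; apply/setP => G.
  rewrite !inE; apply/negP => /andP[_ /eqP Gm].
  by have := max_card (mem G); rewrite Gm leqNgt Tm.
have -> : #|A| = 'C(#|T| - k, m - k).
  have -> : (#|T| - k = #|~: S|)%N by rewrite cardsCs setCK.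
  rewrite -cards_draws; set B := [set _ | _].
  have -> : A = [set S :|: H | H in B].
    apply/setP => G; apply/idP/imsetP => [|[H]]; rewrite !inE.
      move=> /andP[SG /eqP Gm]; exists (G :\: S); last first.
        by rewrite setDE setUIr setUCr setIT (setUidPr SG).
      by rewrite inE subsetDr cardsD (setIidPr SG) Gm eqxx.
    move=> /andP[HS /eqP Hm] ->; rewrite subsetUl cardsU Hm.
    have -> : S :&: H = set0 by rewrite setIC; apply/disjoint_setI0; rewrite disjoints_subset.
    by rewrite cards0 subn0 -/k subnKC // eqxx.
  have recov (H : {set T}) : H \subset ~: S -> (S :|: H) :&: ~: S = H.
    by move=> HS; rewrite setIUl setICr set0U (setIidPl HS).
  rewrite card_in_imset // => H H' /[!inE] /andP[HS _] /andP[HS' _] e.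
  by rewrite -(recov H HS) e recov.
apply/eqP; rewrite -(eqn_pmul2r (fact_gt0 (m - k))) -(eqn_pmul2r (fact_gt0 (#|T| - m))).
have e1 := bin_fact (leq_sub2r k mT); rewrite subnBA // (subnK (leq_trans km mT)) in e1.
have e2 := ffact_fact (leq_trans km mT); have e3 := ffact_fact km.
have e4 := bin_fact mT.
apply/eqP; transitivity ((#|T|)`!); first by rewrite -e2 -e1; ring.
by rewrite -e4 -e3; ring.
Qed.

Lemma Pr_gnm_subset n m (S : graph n) : (m <= 'C(n, 2))%N ->
  Pr (gnm R m) (fun G => S \subset G) =
  (m ^_ #|S|)%:R / ('C(n, 2) ^_ #|S|)%:R.
Proof.
move=> mN; rewrite /Pr /gnm -mulr_suml -natr_sum.
have -> : (\sum_(G : graph n | S \subset G) (#|G| == m))%N =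
    #|[set G : graph n | (S \subset G) && (#|G| == m)]|.
  rewrite -sum1_card big_mkcond [RHS]big_mkcond /=.
  by apply: eq_bigr => G _; rewrite inE; case: (S \subset G) => //=; case: eqP.
have := card_supset_draws S m; rewrite card_draws card_edge => /(congr1 (fun x => x%:R : R)).
rewrite !natrM => e.
have S_le : (#|S| <= 'C(n, 2))%N by rewrite -card_edge max_card.
apply/eqP; rewrite eqr_div ?pnatr_eq0 -?lt0n ?bin_gt0 ?ffact_gt0 //.
by rewrite e mulrC.
Qed.

Lemma gnm_ge0 n m (G : graph n) : 0 <= gnm R m G.
Proof. by rewrite /gnm divr_ge0. Qed.

(** The sum over graphs is the expansion of a product over the potential edges, in
which every edge of [S] has lost the summand for its absence. *)
Lemma Pr_gnp_subset n (p : R) (S : graph n) :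
  Pr (gnp p) (fun G => S \subset G) = p ^+ #|S|.
Proof.
transitivity (\prod_(e : edge n) (p + (e \notin S)%:R * (1 - p))).
  rewrite bigA_distr /= /Pr big_mkcond /=; apply: eq_bigr => G _.
  rewrite (bigID (mem G)) /= /gnp.
  case: (boolP (S \subset G)) => [SG|/subsetPn[e eS eG]].
    rewrite -!prodr_const; congr (_ * _); first by apply: eq_bigr => e ->.
    apply: eq_big => e; rewrite inE // => eG.
    by rewrite (negbTE eG) (contra (subsetP SG e) eG) mul1r.
  symmetry; rewrite [X in _ * X](bigD1 e) //= (negbTE eG) eS mul0r mul0r mulr0 //.
rewrite (bigID (mem S)) /= [X in _ * X]big1 ?mulr1 => [|e ->]; last by rewrite mul1r addrC subrK.
by rewrite -prodr_const; apply: eq_bigr => e ->; rewrite mul0r addr0.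
Qed.

End Moments.

(** * The second moment for a fixed number of edges *)

Section SecondMoment.
Variable R : realType.

Lemma natr_bin2 n : 'C(n, 2)%:R = n%:R * (n%:R - 1) / 2 :> R.
Proof.
have := bin_ffact n 2; rewrite ffactnS ffactn1 (_ : 2`! = 2)%N //.
move=> /(congr1 (fun x => x%:R : R)); rewrite !natrM => e; rewrite -[LHS](mulfK (_ : 2 != 0)) // e.
by case: n {e} => [|n]; rewrite ?mul0r // -[n.+1%:R]natr1 addrK.
Qed.

Lemma ffact_ratioE (m N k : nat) : (k <= m)%N -> (m <= N)%N ->
  (m ^_ k)%:R / (N ^_ k)%:R = \prod_(i < k) ((m%:R - i%:R) / (N%:R - i%:R)) :> R.
Proof.
move=> km mN; elim: k km => [|k IHk] km; first by rewrite big_ord0 !ffactn0 divr1.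
rewrite big_ord_recr /= -IHk ?(ltnW km) // !ffactnSr !natrM.
rewrite !natrB ?(ltnW km) //; last by lia.
by rewrite invfM mulrACA.
Qed.

Lemma ffact_ratio_gt0 (m N k : nat) : (k <= m)%N -> (m <= N)%N ->
  0 < (m ^_ k)%:R / (N ^_ k)%:R :> R.
Proof. by move=> km mN; rewrite divr_gt0 // ltr0n ffact_gt0 //; lia. Qed.

(** Each factor [(N - i) / (m - i)] with [i < K] is at most its value at [i = K],
which is [1 + (N - m) / (m - K)]. *)
Lemma ffact_ratio_backwards (m N K b : nat) : (K < m)%N -> (m <= N)%N -> (b <= K)%N ->
  (m ^_ (K - b))%:R / (N ^_ (K - b))%:R <=
  (m ^_ K)%:R / (N ^_ K)%:R * (1 + (N%:R - m%:R) / (m%:R - K%:R)) ^+ b :> R.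
Proof.
move=> Km mN; set t := 1 + _; elim: b => [|b IHb] bK; first by rewrite subn0 mulr1.
have t0 : 0 <= t.
  by rewrite addr_ge0 // divr_ge0 // subr_ge0 ler_nat //; lia.
rewrite exprSr mulrA.
apply: le_trans (ler_wpM2r t0 (IHb (ltnW bK))).
have -> : (K - b = (K - b.+1).+1)%N by lia.
have : (K - b.+1 < K)%N by lia.
move: (K - b.+1)%N => k kK.
rewrite !ffactnSr !natrM !natrB; try lia.
have mk : 0 < m%:R - k%:R :> R by rewrite subr_gt0 ltr_nat; lia.
have Nk : 0 < N%:R - k%:R :> R by rewrite subr_gt0 ltr_nat; lia.
have mK : 0 < m%:R - K%:R :> R by rewrite subr_gt0 ltr_nat.
have mN' : m%:R <= N%:R :> R by rewrite ler_nat.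
have kK' : k%:R <= K%:R :> R by rewrite ler_nat ltnW.
have -> : (m ^_ k)%:R * (m%:R - k%:R) / ((N ^_ k)%:R * (N%:R - k%:R)) * t =
    (m ^_ k)%:R / (N ^_ k)%:R * ((m%:R - k%:R) / (N%:R - k%:R) * t) :> R.
  by rewrite invfM; ring.
rewrite -[leLHS]mulr1 ler_wpM2l ?divr_ge0 //.
rewrite mulrAC ler_pdivlMr // mul1r /t mulrDr mulr1 -lerBlDl.
have -> : N%:R - k%:R - (m%:R - k%:R) = N%:R - m%:R :> R by ring.
by rewrite mulrCA ler_peMr ?subr_ge0 // ler_pdivlMr // mul1r lerD2l lerN2.
Qed.

(** Factor by factor, [(m - n - i) / (N - n - i)] equals [(m - i) / (N - i)] times
[1 - n (N - m) / ((N - n - i) (m - i))], and [(N - n - i) (m - i) <= N m]. *)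
Lemma ffact_ratio_double (m N n : nat) : (2 * n < m)%N -> (m <= N)%N ->
  (m ^_ (2 * n))%:R / (N ^_ (2 * n))%:R <=
  ((m ^_ n)%:R / (N ^_ n)%:R) ^+ 2 *
    expR (- (n%:R ^+ 2 * (N%:R - m%:R) / (N%:R * m%:R))) :> R.
Proof.
move=> nm mN; rewrite !ffact_ratioE; try lia.
rewrite mul2n -addnn big_split_ord /= expr2 -mulrA.
have pos k (le : (k <= n)%N) : 0 <= \prod_(i < k) ((m%:R - i%:R) / (N%:R - i%:R)) :> R.
  apply: prodr_ge0 => i _; have := ltn_ord i => ik.
  by rewrite divr_ge0 // subr_ge0 ler_nat; lia.
rewrite ler_wpM2l ?pos //.
have -> : - (n%:R ^+ 2 * (N%:R - m%:R) / (N%:R * m%:R)) =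
    \sum_(i < n) - (n%:R * (N%:R - m%:R) / (N%:R * m%:R)) :> R.
  by rewrite sumr_const card_ord -[in RHS]mulr_natl; ring.
rewrite expR_sum -big_split /=; apply: ler_prod => i _.
have iN := ltn_ord i.
have m0 : 0 < m%:R :> R by rewrite ltr0n; lia.
have N0 : 0 < N%:R :> R by rewrite ltr0n; lia.
have n0 : 0 <= n%:R :> R by [].
have i0 : 0 <= i%:R :> R by [].
have mi : 0 < m%:R - i%:R - n%:R :> R.
  by rewrite -addrA -opprD -natrD subr_gt0 ltr_nat; lia.
have mN' : m%:R <= N%:R :> R by rewrite ler_nat.
have Ni : 0 < N%:R - i%:R - n%:R :> R by apply: lt_le_trans mi _; rewrite !lerD2r.
have E x : x - (n%:R + i%:R) = x - i%:R - n%:R :> R by ring.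
rewrite natrD !E.
apply/andP; split; first by rewrite divr_ge0 // ltW.
set c := n%:R * _ / _.
apply: (@le_trans _ _ ((m%:R - i%:R) / (N%:R - i%:R) * (1 - c))); last first.
  by rewrite ler_wpM2l ?expR_ge1Dx // divr_ge0; lra.
rewrite mulrAC ler_pdivlMr; last by lra.
rewrite mulrAC ler_pdivrMr //.
have -> : (m%:R - i%:R - n%:R) * (N%:R - i%:R) =
  (m%:R - i%:R) * (N%:R - i%:R - n%:R) - n%:R * (N%:R - m%:R) :> R by ring.
have -> : (m%:R - i%:R) * (1 - c) * (N%:R - i%:R - n%:R) =
  (m%:R - i%:R) * (N%:R - i%:R - n%:R) - (m%:R - i%:R) * c * (N%:R - i%:R - n%:R) by ring.
rewrite lerD2l lerN2 /c.
have -> : (m%:R - i%:R) * (n%:R * (N%:R - m%:R) / (N%:R * m%:R)) * (N%:R - i%:R - n%:R) =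
  n%:R * (N%:R - m%:R) * (((m%:R - i%:R) * (N%:R - i%:R - n%:R)) / (N%:R * m%:R)) :> R by ring.
rewrite ler_piMr //; first by rewrite mulr_ge0 // subr_ge0.
rewrite ler_pdivrMr ?mulr_gt0 // mul1r mulrC; apply: ler_pM; lra.
Qed.

Local Notation X := (fun G => (num_hamilton_cycles G)%:R : R).

(** With [t = (N - m) / (m - 2 n)], the exponent [2 t - n^2 (N - m) / (N m)] left by
the two estimates is at most [2 (N - m) (1 / (m - 2 n) - 1 / m)], because
[n^2 / N >= 2]; this is of order [q]. *)
Lemma gnm_second_moment (n m : nat) (q := n%:R ^+ 3 / m%:R ^+ 2 : R) :
  (2 < n)%N -> (4 * n <= m <= 'C(n, 2))%N ->
  Ex (gnm R m) (fun G : graph n => X G ^+ 2) <=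
  Ex (gnm R m) (fun G : graph n => X G) ^+ 2 * (expR (4 * q) * (1 + 20 * q)).
Proof.
move=> n2 /andP[nm mN].
have PS := fun S : graph n => Pr_gnm_subset R S mN.
rewrite (Ex_num_hamilton_cycles (f := fun k => (m ^_ k)%:R / ('C(n, 2) ^_ k)%:R)) //.
rewrite (Ex_num_hamilton_cycles_sqr (f := fun k => (m ^_ k)%:R / ('C(n, 2) ^_ k)%:R)) //.
set h := #|_|%:R; set N := 'C(n, 2) in mN PS *.
pose t : R := (N%:R - m%:R) / (m%:R - (2 * n)%:R).
have n0 : 3 <= n%:R :> R by rewrite ler_nat.
have nmR : 4 * n%:R <= m%:R :> R by rewrite -natrM ler_nat.
have mNR : m%:R <= N%:R :> R by rewrite ler_nat.
have NE : N%:R = n%:R * (n%:R - 1) / 2 :> R.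
  exact: natr_bin2.
have m2n : m%:R / 2 <= m%:R - (2 * n)%:R :> R by rewrite natrM; lra.
have t0 : 0 <= t by rewrite divr_ge0 ?subr_ge0 // natrM; lra.
set a := (m ^_ (2 * n))%:R / (N ^_ (2 * n))%:R : R.
have a0 : 0 <= a by rewrite divr_ge0.
apply: (@le_trans _ _ (\sum_(C : graph n | hamilton_cycle C) 
   a * (h * (expR (2 * t) * (1 + 4 * (4 * t ^+ 2 + 2 * t) / n%:R))))).
  apply: ler_sum => C HC; apply: le_trans (ler_wpM2l a0 (sum_pow_overlap_le n2 HC t0)).
  rewrite mulr_sumr; apply: ler_sum => C' HC'.
  apply: ffact_ratio_backwards => //; first by lia.
  have cC : #|C| = n by apply: card_hamilton_cycle; rewrite // inE.
  by have := subset_leq_card (finset.subsetIl C C'); rewrite cC; lia.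
have sum_cst x : \sum_(C : graph n | hamilton_cycle C) x = h * x.
  rewrite sumr_const -mulr_natl /h; congr (_%:R * _).
  by apply: eq_card => C; rewrite inE.
rewrite sum_cst.
have := @ffact_ratio_double m N n; rewrite -/a => /(_ ltac:(lia) mN) ale.
set r := (m ^_ n)%:R / _ in ale *.
set B := 1 + 4 * _ / _.
have B0 : 0 <= B by rewrite addr_ge0 // divr_ge0 // mulr_ge0 // addr_ge0 // mulr_ge0 // exprn_ge0.
have h0 : 0 <= h by [].
apply: (@le_trans _ _ (h * (r ^+ 2 * expR (- (n%:R ^+ 2 * (N%:R - m%:R) / (N%:R * m%:R))) *
   (h * (expR (2 * t) * B))))).
  by rewrite ler_wpM2l // ler_wpM2r // !mulr_ge0 // expR_ge0.
set E1 := - _.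
have -> : h * (r ^+ 2 * expR E1 * (h * (expR (2 * t) * B))) =
    (h * r) ^+ 2 * (expR (E1 + 2 * t) * B).
  by rewrite expRD; ring.
rewrite ler_wpM2l ?sqr_ge0 //.
have m0 : 0 < m%:R :> R by lra.
have m2n0 : 0 < m%:R - (2 * n)%:R :> R by lra.
have tle : t <= n%:R ^+ 2 / m%:R.
  rewrite /t ler_pdivrMr // mulrAC ler_pdivlMr // NE.
  rewrite expr2; nra.
have nmq : n%:R / m%:R <= q / 2.
  have -> : n%:R / m%:R = n%:R * m%:R / m%:R ^+ 2 :> R by field; rewrite gt_eqF.
  rewrite /q [leRHS]mulrAC ler_wpM2r ?invr_ge0 ?exprn_ge0 // (exprS _ 2) -mulrA ler_wpM2l //.
  by apply: le_trans mNR _; rewrite NE expr2; nra.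
apply: ler_pM; rewrite ?expR_ge0 //.
  rewrite ler_expR.
  have : E1 <= - (2 * (N%:R - m%:R) / m%:R).
    rewrite lerN2 invfM !mulrA ler_wpM2r ?invr_ge0 ?(ltW m0) // mulrAC.
    rewrite ler_wpM2r ?subr_ge0 // NE.
    rewrite ler_pdivlMr; first by rewrite expr2; nra.
    by rewrite divr_gt0 // mulr_gt0; lra.
  move=> le1; apply: le_trans (lerD le1 (lexx _)) _.
  have -> : - (2 * (N%:R - m%:R) / m%:R) + 2 * t =
      2 * (N%:R - m%:R) * (2 * n%:R) / (m%:R * (m%:R - (2 * n)%:R)).
    by rewrite /t natrM; field; rewrite -natrM !gt_eqF.
  rewrite /q ler_pdivrMr ?mulr_gt0 //.
  have -> : 4 * (n%:R ^+ 3 / m%:R ^+ 2) * (m%:R * (m%:R - (2 * n)%:R)) =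
     4 * n%:R ^+ 3 * ((m%:R - (2 * n)%:R) / m%:R) :> R by field; rewrite gt_eqF.
  have : 2^-1 <= (m%:R - (2 * n)%:R) / m%:R :> R.
    by rewrite ler_pdivlMr // mulrC.
  move=> /(ler_wpM2l (_ : 0 <= 4 * n%:R ^+ 3)) => /(_ ltac:(by rewrite mulr_ge0 // exprn_ge0)).
  apply: le_trans; rewrite NE (exprS _ 2) expr2; nra.
rewrite /B lerD2l.
have tt : t ^+ 2 <= (n%:R ^+ 2 / m%:R) ^+ 2.
  by rewrite ler_sqr ?nnegrE // divr_ge0 // ?exprn_ge0 // ltW.
have -> : 20 * q = 4 * (4 * q * n%:R + q * n%:R) / n%:R by field; rewrite gt_eqF //; lra.
rewrite ler_wpM2r ?invr_ge0 // ler_wpM2l // lerD //.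
  rewrite -mulrA ler_wpM2l //; apply: le_trans tt _.
  by rewrite le_eqVlt /q; apply/orP; left; apply/eqP; field; rewrite gt_eqF.
apply: le_trans (ler_wpM2l _ tle) _ => //.
have := ler_wpM2r (_ : 0 <= 2 * n%:R) nmq => /(_ ltac:(by rewrite mulr_ge0)).
suff -> : n%:R / m%:R * (2 * n%:R) = 2 * (n%:R ^+ 2 / m%:R) :> R by lra.
by ring.
Qed.

Lemma Ex_gnm_gt0 n m : (2 < n)%N -> (n <= m <= 'C(n, 2))%N ->
  0 < Ex (gnm R m) (fun G : graph n => X G).
Proof.
move=> n2 /andP[nm mN].
have PS := fun S : graph n => Pr_gnm_subset R S mN.
rewrite (Ex_num_hamilton_cycles (f := fun k => (m ^_ k)%:R / ('C(n, 2) ^_ k)%:R)) //.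
by rewrite mulr_gt0 ?ffact_ratio_gt0 // ltr0n hamilton_cycles_gt0.
Qed.

Lemma gnm_concentration (n m : nat) (eps : R) (q := n%:R ^+ 3 / m%:R ^+ 2 : R) :
  (2 < n)%N -> (4 * n <= m <= 'C(n, 2))%N -> 0 < eps ->
  Pr (gnm R m) (fun G : graph n =>
     eps < `|X G / Ex (gnm R m) (fun G : graph n => X G) - 1|) <=
  (expR (4 * q) * (1 + 20 * q) - 1) / eps ^+ 2.
Proof.
move=> n2 nm eps0; have /andP[nm1 mN] := nm.
apply: chebyshev_relative => //.
- by move=> G; exact: gnm_ge0.
- exact: gnm_sum1.
- by apply: Ex_gnm_gt0 => //; lia.
- by rewrite addrCA subrr addr0; exact: gnm_second_moment.
Qed.

End SecondMoment.

(** * Binomial probabilities near the mean *)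

Section LocalLimit.
Variable R : realType.

Lemma ln1D_approx (u : R) : `|u| <= 2^-1 -> `|ln (1 + u) - u| <= 2 * u ^+ 2.
Proof.
rewrite ler_norml => /andP[u1 u2]; have u0 : 0 < 1 + u by lra.
have up : ln (1 + u) <= u by apply: le_ln1Dx; lra.
have lo : u / (1 + u) <= ln (1 + u).
  rewrite -lerN2 -lnV ?posrE //.
  rewrite [X in ln X](_ : _ = 1 + - (u / (1 + u))); last by field; rewrite gt_eqF.
  apply: le_ln1Dx; rewrite ltrN2 ltr_pdivrMr //; lra.
have lo2 : u - 2 * u ^+ 2 <= u / (1 + u) by rewrite ler_pdivlMr // expr2; nra.
have u20 := sqr_ge0 u.
by rewrite ler_norml; apply/andP; split; lra.
Qed.

Lemma ln1D_le (u e : R) : `|u| <= e -> e <= 2^-1 -> `|ln (1 + u)| <= 2 * e.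
Proof.
move=> ue e2; have e0 : 0 <= e := le_trans (normr_ge0 u) ue.
have := ln1D_approx (le_trans ue e2).
have : u ^+ 2 <= e * e.
  by rewrite -expr2 -(real_normK (num_real u)) ler_sqr ?nnegrE.
have : e * e <= e * 2^-1 by rewrite ler_wpM2l.
move: ue; rewrite !ler_norml => /andP[? ?] ? ? /andP[? ?].
by apply/andP; split; lra.
Qed.

Definition binom_pmf (N : nat) (p : R) (k : nat) : R :=
  'C(N, k)%:R * p ^+ k * (1 - p) ^+ (N - k).

Lemma binom_pmf_gt0 N p k : 0 < p < 1 -> (k <= N)%N -> 0 < binom_pmf N p k.
Proof.
move=> /andP[p0 p1] kN; rewrite /binom_pmf !mulr_gt0 ?exprn_gt0 ?subr_gt0 //.
by rewrite ltr0n bin_gt0.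
Qed.

Lemma binom_pmf_sym N p k : (k <= N)%N -> binom_pmf N p k = binom_pmf N (1 - p) (N - k).
Proof.
by move=> kN; rewrite /binom_pmf bin_sub // subKn // opprB addrCA subrr addr0 mulrAC.
Qed.

Lemma binom_pmf_succ N p k : 0 < p < 1 -> (k < N)%N ->
  binom_pmf N p k.+1 = binom_pmf N p k * ((N%:R - k%:R) * p / (k.+1%:R * (1 - p))).
Proof.
move=> /andP[p0 p1] kN; rewrite /binom_pmf.
have := mul_bin_left N k => /(congr1 (fun x => x%:R : R)); rewrite !natrM natrB ?(ltnW kN) // => e.
have q0 : 1 - p != 0 by rewrite gt_eqF // subr_gt0.
have k0 : k.+1%:R != 0 :> R by rewrite pnatr_eq0.
have -> : (N - k = (N - k.+1).+1)%N by lia.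
have {}e : 'C(N, k.+1)%:R = (N%:R - k%:R) * 'C(N, k)%:R / k.+1%:R :> R.
  by rewrite -e mulrAC mulfV ?mul1r.
rewrite e !exprS; move: (k.+1%:R) k0 => a a0; by field; rewrite a0 q0.
Qed.

(** The quotient of the probabilities of [m + i + 1] and [m + i] is
[(1 - i / w) / (1 + (i + 1) / m)] with [w = N - m].  Since [1/w + 1/m = 1/v], its
logarithm is [- (2 i + 1) / (2 v)] up to [4 (j / v)^2 + 1 / v], and
[2 i + 1 = (i + 1)^2 - i^2] telescopes. *)
Lemma binom_pmf_local_right (N m j : nat) (p v : R) :
  0 < p < 1 -> m%:R = p * N%:R -> v = m%:R * (1 - p) ->
  2 * j%:R <= v -> 
  (m + j <= N)%N /\
  `|ln (binom_pmf N p (m + j) / binom_pmf N p m) + j%:R ^+ 2 / (2 * v)| <=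
  j%:R * (4 * (j%:R / v) ^+ 2 + v^-1).
Proof.
move=> p01 mp vE jv; have /andP[p0 p1] := p01.
have q0 : 0 < 1 - p by rewrite subr_gt0.
have jj0 : 0 <= j%:R :> R by [].
have mN : (m <= N)%N by rewrite -(ler_nat R) mp ler_piMl // ltW.
have bm0 := binom_pmf_gt0 p01 mN.
have [j0|j0] := posnP j.
  rewrite j0 addn0; split=> //.
  by rewrite expr0n /= mul0r addr0 divff ?ln1 ?normr0 ?mul0r // gt_eqF.
have jR0 : 0 < j%:R :> R by rewrite ltr0n.
have v0 : 0 < v by lra.
have m0 : 0 < m%:R :> R by rewrite -(pmulr_lgt0 _ q0) -vE.
have N0 : 0 < N%:R :> R by move: m0; rewrite mp pmulr_rgt0.
have m'E : N%:R - m%:R = (1 - p) * N%:R :> R by rewrite mp; ring.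
have vm : v <= m%:R by rewrite vE ler_piMr //; lra.
have vm' : v <= N%:R - m%:R by rewrite m'E vE mp mulrAC ler_wpM2r // ler_piMl //; lra.
have mjN : (m + j <= N)%N by rewrite -(ler_nat R) natrD; lra.
split=> //.
have vV : v^-1 = m%:R^-1 + (N%:R - m%:R)^-1.
  by rewrite m'E vE mp; field; rewrite !gt_eqF.
set w := N%:R - m%:R in m'E vm' vV.
have w0 : 0 < w by lra.
have main i : (i <= j)%N -> `|ln (binom_pmf N p (m + i) / binom_pmf N p m) + i%:R ^+ 2 / (2 * v)| <=
    i%:R * (4 * (j%:R / v) ^+ 2 + v^-1).
  elim: i => [_|i IHi ij].
    by rewrite addn0 expr0n /= mul0r addr0 divff ?ln1 ?normr0 ?mul0r // gt_eqF.
  have miN : (m + i < N)%N by apply: leq_trans mjN; rewrite ltn_add2l.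
  have bi0 := binom_pmf_gt0 p01 (ltnW miN).
  have iR : i%:R + 1 <= j%:R :> R by rewrite natr1 ler_nat.
  have i0 : 0 <= i%:R :> R by [].
  pose a : R := i%:R / w; pose b : R := (i%:R + 1) / m%:R.
  have a0 : 0 <= a by rewrite divr_ge0 // ltW.
  have b0 : 0 <= b by rewrite divr_ge0 ?ltW //; lra.
  have av : a <= j%:R / v.
    by apply: ler_pM; rewrite ?invr_ge0 ?(ltW w0) ?lef_pV2 ?posrE //; lra.
  have bv : b <= j%:R / v.
    by apply: ler_pM; rewrite ?invr_ge0 ?(ltW m0) ?lef_pV2 ?posrE //; lra.
  have jv2 : j%:R / v <= 2^-1 by rewrite ler_pdivrMr //; lra.
  have stepE : binom_pmf N p (m + i.+1) / binom_pmf N p m =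
     (binom_pmf N p (m + i) / binom_pmf N p m) * ((1 - a) / (1 + b)).
    rewrite addnS binom_pmf_succ // -natr1 natrD mulrAC; congr (_ * _).
    have -> : N%:R - (m%:R + i%:R) = w - i%:R :> R by rewrite /w; ring.
    have mi0 : m%:R + i%:R + 1 != 0 :> R by rewrite gt_eqF //; lra.
    have mi0' : m%:R + (i%:R + 1) != 0 :> R by rewrite gt_eqF //; lra.
    have -> : (1 - a) / (1 + b) = (w - i%:R) * m%:R / (w * (m%:R + i%:R + 1)).
      by rewrite /a /b; field; rewrite ?mi0 ?mi0' !gt_eqF.
    by rewrite m'E mp; field; rewrite -mp mi0 !gt_eqF.
  have a1 : 0 < 1 - a by lra.
  have b1 : 0 < 1 + b by lra.
  rewrite stepE lnM ?posrE ?(divr_gt0 a1 b1) ?(divr_gt0 bi0 bm0) //.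
  have -> : ln ((1 - a) / (1 + b)) = ln (1 - a) - ln (1 + b) by rewrite ln_div ?posrE.
  have la : `|ln (1 + - a) - - a| <= 2 * (- a) ^+ 2.
    by apply: ln1D_approx; rewrite normrN ger0_norm //; lra.
  have lb : `|ln (1 + b) - b| <= 2 * b ^+ 2.
    by apply: ln1D_approx; rewrite ger0_norm //; lra.
  have a2 : a ^+ 2 <= (j%:R / v) ^+ 2 by rewrite ler_sqr ?nnegrE // divr_ge0 // ltW.
  have b2 : b ^+ 2 <= (j%:R / v) ^+ 2 by rewrite ler_sqr ?nnegrE // divr_ge0 // ltW.
  have abE : a + b = i%:R * v^-1 + m%:R^-1 by rewrite vV /a /b; ring.
  have sqE : i.+1%:R ^+ 2 / (2 * v) = i%:R ^+ 2 / (2 * v) + i%:R * v^-1 + v^-1 / 2.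
    by rewrite -natr1; field; rewrite gt_eqF.
  have mV : 0 < m%:R^-1 :> R by rewrite invr_gt0.
  have mV' : m%:R^-1 <= v^-1 by rewrite vV lerDl invr_ge0 ltW.
  have := IHi (ltnW ij).
  rewrite sqE -(natr1 i); move: la lb; rewrite sqrrN opprK !ler_norml.
  move: (ln _) (ln _) (ln _) => L1 L2 L3; clear -a2 b2 abE mV mV'.
  move=> /andP[? ?] /andP[? ?] /andP[? ?].
  by apply/andP; split; lra.
exact: main.
Qed.

(** Below the mean, exchange edges and non-edges, that is [p] and [1 - p]: [v] does
not change. *)
Lemma binom_pmf_local (N m k : nat) (p v : R) :
  0 < p < 1 -> m%:R = p * N%:R -> v = m%:R * (1 - p) ->
  2 * `|k%:R - m%:R| <= v -> 
  (k <= N)%N /\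
  `|ln (binom_pmf N p k / binom_pmf N p m) + (k%:R - m%:R) ^+ 2 / (2 * v)| <=
  `|k%:R - m%:R| * (4 * (`|k%:R - m%:R| / v) ^+ 2 + v^-1).
Proof.
move=> p01 mp vE; have /andP[p0 p1] := p01.
have mN : (m <= N)%N by rewrite -(ler_nat R) mp ler_piMl // ltW.
have [mk|km] := leqP m k.
  have -> : k%:R - m%:R = (k - m)%:R :> R by rewrite natrB.
  rewrite normr_nat => kv.
  by have := binom_pmf_local_right p01 mp vE kv; rewrite subnKC.
have kN : (k <= N)%N by lia.
rewrite distrC -sqrrN opprB.
have -> : m%:R - k%:R = (m - k)%:R :> R by rewrite natrB // ltnW.
rewrite normr_nat => kv; split=> //.
have p01' : 0 < 1 - p < 1 by apply/andP; split; lra.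
have mp' : (N - m)%:R = (1 - p) * N%:R by rewrite natrB // mp; ring.
have vE' : v = (N - m)%:R * (1 - (1 - p)) by rewrite mp' vE mp; ring.
have [_] := binom_pmf_local_right p01' mp' vE' kv.
have kE : (N - (N - m + (m - k)) = k)%N by lia.
rewrite (binom_pmf_sym _ (leq_subr m N)) subKn //.
rewrite (@binom_pmf_sym N _ (N - m + (m - k))) ?kE //; last by lia.
by rewrite opprB addrCA subrr addr0.
Qed.

End LocalLimit.

(** * The Gaussian distribution function *)

Section NormalCDF.
Local Open Scope classical_set_scope.
Variable R : realType.
Notation gauss := (normal_prob (0 : R) 1).

Definition normal_cdf (y : R) : R := fine (gauss `]-oo, y]).

Lemma normal_cdfE y : gauss `]-oo, y] = (normal_cdf y)%:E.
Proof. by rewrite /normal_cdf fineK // fin_num_measure. Qed.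

Lemma normal_cdf_ge0 y : 0 <= normal_cdf y.
Proof. by rewrite fine_ge0. Qed.

Lemma normal_cdf_le1 y : normal_cdf y <= 1.
Proof. by rewrite -lee_fin -normal_cdfE probability_le1. Qed.

Lemma normal_cdf_le x y : x <= y -> normal_cdf x <= normal_cdf y.
Proof.
by move=> xy; rewrite -lee_fin -!normal_cdfE le_measure ?inE //; exact: subitvPr.
Qed.

Lemma normal_cdf_itv a b : a <= b ->
  ((normal_cdf b - normal_cdf a)%:E = gauss `]a, b])%E.
Proof.
move=> ab; have : gauss `]-oo, b] = (gauss `]-oo, a] + gauss `]a, b])%E.
  rewrite (@itv_bndbnd_setU _ _ -oo%O (BRight a) (BRight b)) ?bnd_simp // measureU //.
  by rewrite -subset0 => x [] /=; rewrite !in_itv /= => h /andP[]; rewrite ltNge h.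
rewrite !normal_cdfE => e.
by rewrite EFinB e [LHS]addeC addeA [X in (X + _)%E]addeC subee ?add0e.
Qed.

Lemma normal_cdf_sub_le a b c : a <= b -> 0 <= c ->
  (forall x, a < x <= b -> normal_pdf 0 1 x <= c) ->
  normal_cdf b - normal_cdf a <= c * (b - a).
Proof.
move=> ab c0 h; rewrite -lee_fin normal_cdf_itv // /normal_prob.
apply: (@le_trans _ _ (\int[lebesgue_measure]_(x in `]a, b]) c%:E)%E).
  apply: ge0_le_integral => //.
  - by move=> x _; rewrite lee_fin normal_pdf_ge0.
  - by apply/measurable_EFinP; apply: measurable_funTS; exact: measurable_normal_pdf.
rewrite integral_cst //= lebesgue_measure_itv /= lte_fin.
case: ltP => [_|ba]; first by rewrite -EFinB -EFinM.
by rewrite mule0 lee_fin mulr_ge0 // subr_ge0.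
Qed.

Lemma normal_cdf_sub_ge a b c : a <= b -> 0 <= c ->
  (forall x, a < x <= b -> c <= normal_pdf 0 1 x) ->
  c * (b - a) <= normal_cdf b - normal_cdf a.
Proof.
move=> ab c0 h; rewrite -lee_fin normal_cdf_itv // /normal_prob.
apply: (@le_trans _ _ (\int[lebesgue_measure]_(x in `]a, b]) c%:E)%E); last first.
  apply: ge0_le_integral => //.
  - by apply/measurable_EFinP; apply: measurable_funTS; exact: measurable_normal_pdf.
rewrite integral_cst //= lebesgue_measure_itv /= lte_fin.
case: ltP => [_|ba]; first by rewrite -EFinB -EFinM.
have -> : a = b by apply/eqP; rewrite eq_le ab.
by rewrite subrr mulr0 mule0.
Qed.

Lemma normal_pdf01 x : normal_pdf 0 1 x = normal_peak 1 * expR (- (x ^+ 2 / 2)) :> R.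
Proof.
rewrite normal_pdfE ?oner_neq0 // /normal_fun subr0 expr1n mulNr.
by congr (_ * expR (- (_ / _))).
Qed.

Lemma normal_peak1_gt0 : 0 < normal_peak 1 :> R.
Proof. by rewrite normal_peak_gt0 // oner_neq0. Qed.

Lemma normal_cdf_lip x h : 0 <= h -> normal_cdf (x + h) <= normal_cdf x + normal_peak 1 * h.
Proof.
move=> h0; rewrite -lerBlDl.
have -> : normal_peak 1 * h = normal_peak 1 * (x + h - x) by rewrite addrAC subrr add0r.
apply: normal_cdf_sub_le; rewrite ?lerDl ?normal_peak_ge0 // => y _.
by rewrite normal_pdf_ub // oner_neq0.
Qed.

(** On the cell the exponent [y^2 / 2] varies by at most [(A + 1) h], so the mass is
the length times the density at the left end, up to that factor. *)
Lemma normal_cdf_cell (A x h : R) : `|x| <= A -> 0 <= h <= 1 ->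
  expR (- ((A + 1) * h)) * (normal_peak 1 * h * expR (- (x ^+ 2 / 2))) <=
    normal_cdf (x + h) - normal_cdf x <=
  expR ((A + 1) * h) * (normal_peak 1 * h * expR (- (x ^+ 2 / 2))).
Proof.
move=> xA /andP[h0 h1]; have c0 := normal_peak1_gt0.
have dE : x + h - x = h by rewrite addrAC subrr add0r.
have A0 : 0 <= A by apply: le_trans xA.
have sq y : x < y <= x + h -> `|y ^+ 2 / 2 - x ^+ 2 / 2| <= (A + 1) * h.
  move=> /andP[xy yx]; have -> : y ^+ 2 / 2 - x ^+ 2 / 2 = (y - x) * ((y + x) / 2) by field.
  rewrite normrM mulrC; apply: ler_pM => //; last by rewrite ger0_norm; lra.
  by move: xA; rewrite !ler_norml => /andP[? ?]; apply/andP; split; lra.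
have xxh : x <= x + h by rewrite lerDl.
apply/andP; split.
  have -> : expR (- ((A + 1) * h)) * (normal_peak 1 * h * expR (- (x ^+ 2 / 2))) =
    normal_peak 1 * expR (- ((A + 1) * h) - x ^+ 2 / 2) * (x + h - x).
    by rewrite dE expRD; ring.
  apply: normal_cdf_sub_ge => // [|y /sq]; first by rewrite mulr_ge0 ?expR_ge0 ?ltW.
  rewrite normal_pdf01 ler_norml => /andP[? ?].
  by rewrite ler_wpM2l ?(ltW c0) // ler_expR; lra.
have -> : expR (((A + 1) * h)) * (normal_peak 1 * h * expR (- (x ^+ 2 / 2))) =
  normal_peak 1 * expR (((A + 1) * h) - x ^+ 2 / 2) * (x + h - x).
  by rewrite dE expRD; ring.
apply: normal_cdf_sub_le => // [|y /sq]; first by rewrite mulr_ge0 ?expR_ge0 ?ltW.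
rewrite normal_pdf01 ler_norml => /andP[? ?].
by rewrite ler_wpM2l ?(ltW c0) // ler_expR; lra.
Qed.

(** The Gaussian measure as the law of the identity variable, for which the limits
of a distribution function are known. *)
Let idTR : measurableTypeR R -> R := idfun.

#[local] HB.instance Definition _ :=
  @isMeasurableFun.Build _ _ _ _ idTR (@measurable_id _ _ setT).

Lemma cvg_normal_cdfy : normal_cdf x @[x --> +oo] --> (1 : R).
Proof. exact: (fine_cvg (@cvg_cdfy1 _ _ _ gauss (idTR : {RV gauss >-> R}))). Qed.

Lemma cvg_normal_cdfNy : normal_cdf x @[x --> -oo] --> (0 : R).
Proof. exact: (fine_cvg (@cvg_cdfNy0 _ _ _ gauss (idTR : {RV gauss >-> R}))). Qed.

Lemma normal_cdf_tails (eps : R) : 0 < eps ->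
  \forall A \near +oo, 1 - eps <= normal_cdf A /\ normal_cdf (1 - A) <= eps.
Proof.
move=> e0.
have [M [_ MP]] : \forall x \near -oo, normal_cdf x <= eps.
  have /cvgrPdist_le/(_ _ e0) : normal_cdf x @[x --> -oo] --> (0 : R) := cvg_normal_cdfNy.
  by apply: filterS => x; rewrite sub0r normrN ler_norml => /andP[].
near=> A; split.
  have : `|1 - normal_cdf A| <= eps.
    by near: A; move/cvgrPdist_le : cvg_normal_cdfy; apply.
  by rewrite ler_norml; lra.
apply: MP; have : 1 - M < A by near: A; apply: nbhs_pinfty_gt; rewrite num_real.
lra.
Unshelve. all: by end_near. Qed.

End NormalCDF.

(** * The number of edges of the binomial graph *)

Section DeMoivreLaplace.
Variable R : realType.

Lemma gnp_ge0 n (p : R) (G : graph n) : 0 < p < 1 -> 0 <= gnp p G.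
Proof. by move=> /andP[p0 p1]; rewrite /gnp mulr_ge0 // exprn_ge0 ?subr_ge0 // ltW. Qed.

Lemma Pr_le (T : finType) (w : T -> R) (P Q : pred T) : (forall x, 0 <= w x) ->
  (forall x, P x -> Q x) -> Pr w P <= Pr w Q.
Proof.
move=> w0 PQ; rewrite /Pr big_mkcond [leRHS]big_mkcond /=; apply: ler_sum => x _.
by case: ifP => [/PQ -> //|_]; case: ifP.
Qed.

Lemma Pr_leU (T : finType) (w : T -> R) (P Q S : pred T) : (forall x, 0 <= w x) ->
  (forall x, P x -> Q x || S x) -> Pr w P <= Pr w Q + Pr w S.
Proof.
move=> w0 PQ; rewrite /Pr big_mkcond [X in _ <= X + _]big_mkcond [X in _ <= _ + X]big_mkcond /=.
rewrite -big_split /=; apply: ler_sum => x _.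
have := w0 x; have := PQ x; case: (P x) (Q x) (S x) => [] [] [] //= h; try lra.
Qed.

Lemma Pr_gnp_card n (p : R) (P : pred nat) :
  Pr (@gnp R n p) (fun G => P #|G|) = \sum_(k < 'C(n, 2).+1 | P k) binom_pmf 'C(n, 2) p k.
Proof.
have cG (G : graph n) : (#|G| < 'C(n, 2).+1)%N by rewrite ltnS -card_edge max_card.
rewrite /Pr (partition_big (fun G : graph n => Ordinal (cG G)) (fun k => P (val k))) //=.
apply: eq_bigr => k Pk.
transitivity (\sum_(G in [set G : graph n | #|G| == k]) p ^+ k * (1 - p) ^+ ('C(n, 2) - k)).
  apply: eq_big => [G|G /andP[_ /eqP <-]].
    by rewrite inE -val_eqE /=; apply/andP/idP => [[]//|/eqP Gk]; rewrite Gk Pk eqxx.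
  have cC : #|finset.setC G| = ('C(n, 2) - #|G|)%N.
    by rewrite [LHS]cardsCs finset.setCK card_edge.
  by rewrite /gnp cC.
by rewrite sumr_const card_draws card_edge /binom_pmf -mulrA mulr_natl.
Qed.

Lemma Pr_gnp_card_itv n (p : R) k0 k1 : (k1 <= 'C(n, 2).+1)%N ->
  Pr (@gnp R n p) (fun G => (k0 <= #|G| < k1)%N) = \sum_(k0 <= k < k1) binom_pmf 'C(n, 2) p k.
Proof.
move=> k1N; rewrite (@Pr_gnp_card n p (fun k => k0 <= k < k1)%N).
rewrite (big_nat_widen _ _ _ _ _ k1N) big_geq_mkord.
by apply: eq_bigl => k; rewrite andbC.
Qed.

(** Expanding the square of [#|G|], a sum of indicators, requires only the
probabilities of containing one or two given edges. *)
Lemma gnp_edges_var n (p : R) (m := p * 'C(n, 2)%:R) :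
  Ex (gnp p) (fun G : graph n => (#|G|%:R - m) ^+ 2) = m * (1 - p).
Proof.
have cardE (G : graph n) : #|G|%:R = \sum_(e : edge n) ([set e]%SET \subset G)%:R :> R.
  rewrite -sum1_card natr_sum big_mkcond /=; apply: eq_bigr => e _.
  by rewrite finset.sub1set; case: (e \in G).
have E1 : Ex (gnp p) (fun G : graph n => #|G|%:R) = m.
  rewrite /Ex; under eq_bigr do rewrite cardE mulr_sumr.
  rewrite exchange_big /= /m mulr_natr -(card_edge n) -sumr_const.
  apply: eq_bigr => e _; rewrite -/(Ex (gnp p) _) (Ex_subset (f := fun k => p ^+ k)).
    by rewrite cards1.
  by move=> S; exact: Pr_gnp_subset.
have E2 : Ex (gnp p) (fun G : graph n => #|G|%:R ^+ 2) = m + m ^+ 2 - m * p.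
  rewrite /Ex; under eq_bigr do rewrite cardE expr2 big_distrlr mulr_sumr.
  rewrite exchange_big /=.
  transitivity (\sum_(e : edge n) \sum_(f : edge n) (p ^+ 2 + (p - p ^+ 2) * (e == f)%:R)).
    apply: eq_bigr => e _; under eq_bigr do rewrite mulr_sumr.
    rewrite exchange_big /=; apply: eq_bigr => f _.
    transitivity (Ex (gnp p) (fun G : graph n => ([set e; f]%SET \subset G)%:R)).
      by apply: eq_bigr => G _; rewrite finset.subUset -natrM mulnb.
    rewrite (Ex_subset (f := fun k => p ^+ k)); last by move=> S; exact: Pr_gnp_subset.
    by rewrite cards2; case: eqVneq => _ /=; rewrite ?expr1; ring.
  have in1 (e : edge n) : \sum_(f : edge n) (p ^+ 2 + (p - p ^+ 2) * (e == f)%:R) =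
     'C(n, 2)%:R * p ^+ 2 + (p - p ^+ 2).
    rewrite big_split /= sumr_const card_edge -mulr_sumr (bigD1 e) //= eqxx.
    rewrite big1 ?addr0 ?mulr1 ?mulr_natl //.
    by move=> f; rewrite eq_sym => /negbTE ->.
  under eq_bigr do rewrite in1.
  by rewrite sumr_const card_edge -mulr_natl /m; ring.
have -> : Ex (gnp p) (fun G : graph n => (#|G|%:R - m) ^+ 2) =
   Ex (gnp p) (fun G : graph n => #|G|%:R ^+ 2) -
   2 * m * Ex (gnp p) (fun G : graph n => #|G|%:R) + m ^+ 2 * \sum_(G : graph n) gnp p G.
  rewrite /Ex !mulr_sumr -sumrB -big_split /=; apply: eq_bigr => G _; ring.
rewrite E1 E2 gnp_sum1; ring.
Qed.

Lemma gnp_edges_tail n (p : R) (A : R) (m := p * 'C(n, 2)%:R) : 0 < p < 1 -> 0 < A ->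
  0 < m * (1 - p) ->
  Pr (gnp p) (fun G : graph n => A ^+ 2 * (m * (1 - p)) < (#|G|%:R - m) ^+ 2) <= (A ^+ 2)^-1.
Proof.
move=> p01 A0 v0; rewrite -[leRHS]mul1r ler_pdivlMr ?exprn_gt0 // -(ler_pM2r v0) mul1r.
rewrite -[leRHS]gnp_edges_var /Pr /Ex -mulrA mulr_suml.
rewrite [leRHS](bigID (fun G : graph n => A ^+ 2 * (m * (1 - p)) < (#|G|%:R - m) ^+ 2)) /=.
rewrite ler_wpDr //; first by apply: sumr_ge0 => G _; rewrite mulr_ge0 ?sqr_ge0 ?gnp_ge0.
by apply: ler_sum => G h; rewrite ler_wpM2l ?gnp_ge0 // ltW.
Qed.

Section Window.
Variables (N m : nat) (p A s : R).
Hypotheses (p01 : 0 < p < 1) (mp : m%:R = p * N%:R) (sE : s ^+ 2 = m%:R * (1 - p)).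
Hypotheses (A1 : 1 <= A) (s1 : 1 <= s) (As : 2 * A <= s).
Local Notation x k := ((k%:R - m%:R) / s).
Local Notation theta := ((4 * A ^+ 3 + 2 * A + 1) / s).
(** The factor from Gaussian to binomial mass; it tends to 1, but this is only
known after summing over a window. *)
Definition window_scale := binom_pmf N p m * s / normal_peak 1.

Lemma binom_cell (k : nat) : `|k%:R - m%:R| <= A * s ->
  (k <= N)%N /\
  window_scale * expR (- theta) * (normal_cdf (x k.+1) - normal_cdf (x k)) <= binom_pmf N p k
  <= window_scale * expR theta * (normal_cdf (x k.+1) - normal_cdf (x k)).
Proof.
move=> dk; have s0 : 0 < s := lt_le_trans ltr01 s1.
have A0 : 0 < A := lt_le_trans ltr01 A1.
have dv : 2 * `|k%:R - m%:R| <= s ^+ 2.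
  by apply: (@le_trans _ _ (2 * (A * s))); rewrite ?ler_pM2l // mulrA expr2 ler_wpM2r // ltW.
have [kN loc] := binom_pmf_local p01 mp sE dv.
split=> //.
have mN : (m <= N)%N by have /andP[p0 p1] := p01; rewrite -(ler_nat R) mp ler_piMl // ltW.
have bm0 := binom_pmf_gt0 p01 mN; have bk0 := binom_pmf_gt0 p01 kN.
have xA : `|x k| <= A by rewrite normrM normfV (gtr0_norm s0) ler_pdivrMr.
have h01 : 0 <= s^-1 <= 1 by rewrite invr_ge0 (ltW s0) invf_le1.
have xS : x k.+1 = x k + s^-1 by rewrite -natr1; ring.
have /andP[lo hi] := normal_cdf_cell xA h01; rewrite -xS in lo hi.
have sqE : (k%:R - m%:R) ^+ 2 / (2 * s ^+ 2) = (x k) ^+ 2 / 2 by field; rewrite gt_eqF.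
have errE : `|k%:R - m%:R| * (4 * (`|k%:R - m%:R| / s ^+ 2) ^+ 2 + (s ^+ 2)^-1) <=
    (4 * A ^+ 3 + A) / s.
  have -> : (4 * A ^+ 3 + A) / s = (A * s) * (4 * (A / s) ^+ 2 + (s ^+ 2)^-1).
    by field; rewrite gt_eqF.
  apply: ler_pM => //; first by rewrite addr_ge0 ?invr_ge0 ?sqr_ge0 // mulr_ge0 ?sqr_ge0.
  rewrite lerD2r ler_pM2l // ler_sqr ?nnegrE ?divr_ge0 ?sqr_ge0 ?(ltW s0) ?(ltW A0) //.
  have -> : A / s = A * s / s ^+ 2 by field; rewrite gt_eqF.
  by rewrite ler_wpM2r // invr_ge0 sqr_ge0.
have {loc errE} := le_trans loc errE; rewrite sqE ler_norml.
set y := x k in xA xS lo hi sqE *; set D := normal_cdf _ - _ in lo hi *.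
set eta := (_ + A) / s => /andP[l1 l2].
have bE : binom_pmf N p k = binom_pmf N p m * expR (ln (binom_pmf N p k / binom_pmf N p m)).
  by rewrite lnK ?posrE ?divr_gt0 // mulrCA divff ?mulr1 // gt_eqF.
have c0 := @normal_peak1_gt0 R.
have thE : theta = eta + (A + 1) * s^-1 by rewrite /eta; ring.
have WE : window_scale = binom_pmf N p m / (normal_peak 1 * s^-1).
  by rewrite /window_scale; field; rewrite !gt_eqF.
have hc0 : 0 < normal_peak 1 * s^-1 :> R by rewrite mulr_gt0 // invr_gt0.
set a := (A + 1) / s in lo hi thE *; set ch := normal_peak 1 / s in hc0 lo hi WE *.
set r := binom_pmf N p k / _ in bE l1 l2; set g := expR (- (y ^+ 2 / 2)) in lo hi.
have W0 : 0 < window_scale by rewrite WE divr_gt0.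
have r0 : 0 < r by rewrite divr_gt0.
have r1 : expR (- eta) * g <= r by rewrite -[leRHS]lnK ?posrE // -expRD ler_expR; lra.
have r2 : r <= expR eta * g by rewrite -[leLHS]lnK ?posrE // -expRD ler_expR; lra.
rewrite bE lnK ?posrE // thE opprD !expRD; apply/andP; split.
  apply: (@le_trans _ _ (binom_pmf N p m * (expR (- eta) * g))); last by rewrite ler_pM2l.
  have -> : binom_pmf N p m * (expR (- eta) * g) =
      window_scale * (expR (- eta) * expR (- a)) * (expR a * (ch * g)).
    by rewrite WE !expRN; field; rewrite ?gt_eqF ?expR_gt0.
  by rewrite ler_wpM2l // mulr_ge0 ?(ltW W0) // mulr_ge0 ?expR_ge0.
apply: (@le_trans _ _ (binom_pmf N p m * (expR eta * g))); first by rewrite ler_pM2l.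
have -> : binom_pmf N p m * (expR eta * g) =
    window_scale * (expR eta * expR a) * (expR (- a) * (ch * g)).
  by rewrite WE !expRN; field; rewrite ?gt_eqF ?expR_gt0.
by rewrite ler_wpM2l // mulr_ge0 ?(ltW W0) // mulr_ge0 ?expR_ge0.
Qed.

Lemma binom_window (k0 k1 : nat) : (k0 <= k1)%N ->
  (forall k, (k0 <= k < k1)%N -> `|k%:R - m%:R| <= A * s) ->
  window_scale * expR (- theta) * (normal_cdf (x k1) - normal_cdf (x k0)) <=
    \sum_(k0 <= k < k1) binom_pmf N p k
  <= window_scale * expR theta * (normal_cdf (x k1) - normal_cdf (x k0)).
Proof.
move=> k01 win; rewrite -(telescope_sumr (fun k => normal_cdf (x k)) k01) !mulr_sumr.
by apply/andP; split; apply: ler_sum_nat => k /win /binom_cell [_ /andP[]].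
Qed.

End Window.

(** The real algebra behind the next lemma.  [S] and [T] are the binomial
masses of the part of the window up to [y] and of the whole window, [cx - c0] and
[c1 - c0] the corresponding Gaussian masses; comparing [T] with 1 bounds the unknown scale [W] on both
sides, and [S] then transfers to [F]. *)
Let eliminate_scale (W e e' a t F S T c0 c1 cN cA cy cx ch : R) :
  0 < W -> 0 < e -> 0 < e' -> e' * e = 1 ->
  0 <= c0 -> c1 <= 1 -> c0 <= cN -> cA <= c1 -> cy <= cx -> cx <= ch -> cN <= cy ->
  cN <= cA -> 0 <= ch -> t <= a -> 1 <= T + t -> T <= 1 -> S <= F -> F <= S + t ->
  W * e' * (c1 - c0) <= T -> T <= W * e * (c1 - c0) ->
  W * e' * (cx - c0) <= S -> S <= W * e * (cx - c0) ->
  e' * e' * (1 - a) * (cy - cN) <= F /\ (F - a) * (cA - cN) <= e * e * ch.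
Proof.
move=> W0 e0 e0' ee c00 c11 c0N cA1 cyx cxh cNy cNA ch0 ta Tt T1 SF FS T2 T3 S1 S2.
have We : 0 < W * e by rewrite mulr_gt0.
have We' : 0 < W * e' by rewrite mulr_gt0.
split.
  apply: le_trans SF; apply: le_trans S1.
  have K1 : 1 - a <= W * e.
    have : W * e * (c1 - c0) <= W * e * 1 by rewrite ler_pM2l //; lra.
    lra.
  have K2 : e' * e' * (1 - a) <= W * e'.
    have -> : W * e' = e' * e' * (W * e) by rewrite -[LHS]mulr1 -ee; ring.
    by rewrite ler_pM2l ?mulr_gt0.
  apply: (@le_trans _ _ (W * e' * (cy - cN))).
    by rewrite ler_wpM2r // subr_ge0.
  by rewrite ler_pM2l //; lra.
have K1 : W * e' * (cA - cN) <= 1.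
  by apply: le_trans (le_trans T2 T1); rewrite ler_pM2l //; lra.
have F1 : F - a <= W * e * ch.
  have : W * e * (cx - c0) <= W * e * ch by rewrite ler_pM2l //; lra.
  lra.
apply: le_trans (ler_wpM2r _ F1) _; first by rewrite subr_ge0.
have -> : W * e * ch * (cA - cN) = e * e * ch * (W * e' * (cA - cN)).
  by rewrite -[LHS]mulr1 -ee; ring.
by rewrite -[leRHS]mulr1 ler_wpM2l // !mulr_ge0 // ltW.
Qed.

(** The window runs from [m - J] to [m + J] with [J] the integer part of [A s]:
outside of it Chebyshev's inequality bounds the binomial mass by [1 / A^2], and
the Gaussian mass is controlled by the tails beyond [A - 1]. *)
Lemma de_moivre_laplace_bounds n (m : nat) (p A s y : R) :
  0 < p < 1 -> m%:R = p * 'C(n, 2)%:R -> s ^+ 2 = m%:R * (1 - p) ->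
  1 <= A -> 1 <= s -> 2 * A <= s -> `|y| + 1 <= A ->
  let F := Pr (gnp p) (fun G : graph n => (#|G|%:R - m%:R) / s <= y) in
  let theta := (4 * A ^+ 3 + 2 * A + 1) / s in
  expR (- (2 * theta)) * (1 - (A ^+ 2)^-1) * (normal_cdf y - normal_cdf (1 - A)) <= F /\
  (F - (A ^+ 2)^-1) * (normal_cdf A - normal_cdf (1 - A)) <=
    expR (2 * theta) * normal_cdf (y + s^-1).
Proof.
move=> p01 mp sE A1 s1 As yA F theta.
have s0 : 0 < s by lra.
have A0 : 0 < A by lra.
have /andP[p0 p1] := p01.
have v0 : 0 < m%:R * (1 - p) by rewrite -sE exprn_gt0.
have N0 : (m <= 'C(n, 2))%N by rewrite -(ler_nat R) mp ler_piMl // ltW.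
have As0 : 0 <= A * s by rewrite mulr_ge0 // ltW.
set J := Num.truncn (A * s).
have /andP[J1 J2] := truncn_itv As0; rewrite -/J in J1 J2.
have Asv : 2 * (A * s) <= s ^+ 2 by rewrite mulrA expr2 ler_wpM2r // ltW.
have Jm : (J <= m)%N.
  rewrite -(ler_nat R); apply: le_trans J1 _.
  have : m%:R * (1 - p) <= m%:R by rewrite ler_piMr //; lra.
  lra.
pose k0 := (m - J)%N; pose k1 := (m + J).+1.
have k0E : k0%:R = m%:R - J%:R :> R by rewrite natrB.
have k1E : k1%:R = m%:R + J%:R + 1 :> R by rewrite /k1 -natr1 natrD.
have win k : (k0 <= k < k1)%N -> `|k%:R - m%:R| <= A * s.
  move=> /andP[kk0 kk1]; have : k0%:R <= k%:R :> R by rewrite ler_nat.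
  have : k%:R <= (m + J)%:R :> R by rewrite ler_nat.
  rewrite natrD k0E => h1 h2; rewrite ler_norml; apply/andP; split; lra.
have k1N : (k1 <= 'C(n, 2).+1)%N.
  have [] // := @binom_cell 'C(n, 2) m p A s p01 mp sE A1 s1 As (m + J).
  by apply: win; rewrite /k0 /k1 ltnSn andbT (leq_trans (leq_subr _ _)) ?leq_addr.
have ny : - `|y| <= y by rewrite lerNl ler_normr lexx orbT.
have my0 : 0 <= m%:R + y * s.
  have : k0%:R <= m%:R + y * s; last by apply: le_trans.
  have : (- A + 1) * s <= y * s by rewrite ler_wpM2r ?(ltW s0) //; lra.
  rewrite k0E; lra.
set ky := (Num.truncn (m%:R + y * s)).+1.
have /andP[ky1 ky2] := truncn_itv my0; rewrite -/ky in ky2.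
have kyE : ky%:R = (Num.truncn (m%:R + y * s))%:R + 1 :> R by rewrite -natr1.
have yAs : - (A - 1) * s <= y * s <= (A - 1) * s.
  have : `|y| <= A - 1 by lra.
  by rewrite ler_norml => /andP[? ?]; rewrite !ler_wpM2r ?(ltW s0).
have /andP[yAs1 yAs2] := yAs.
have k0y : (k0 <= ky)%N by rewrite -(ler_nat R) k0E; lra.
have ky1' : (ky <= k1)%N by rewrite /k1 ltnS -ltnS -(ltr_nat R) -/k1 k1E; lra.
have kyP (k : nat) : ((k%:R - m%:R) / s <= y) = (k < ky)%N.
  by rewrite ler_pdivrMr // lerBlDl /ky ltnS truncn_ge_nat.
pose tail := Pr (gnp p) (fun G : graph n => A ^+ 2 * (m%:R * (1 - p)) < (#|G|%:R - m%:R) ^+ 2).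
have tailA : tail <= (A ^+ 2)^-1.
  by have := @gnp_edges_tail n p A p01 A0; rewrite -mp; apply.
have outside (G : graph n) : ~~ (k0 <= #|G| < k1)%N -> 
    A ^+ 2 * (m%:R * (1 - p)) < (#|G|%:R - m%:R) ^+ 2.
  rewrite -sE -exprMn negb_and -!ltnNge => h.
  rewrite -[ltRHS]real_normK ?num_real // ltr_sqr ?nnegrE //.
  case/orP: h => h.
    have : #|G|%:R + 1 <= k0%:R :> R by rewrite natr1 ler_nat.
    by rewrite k0E ltr_normr => h'; apply/orP; right; lra.
  have : k1%:R <= #|G|%:R :> R by rewrite ler_nat -ltnS.
  by rewrite k1E ltr_normr => h'; apply/orP; left; lra.
have w0 G : 0 <= gnp p G := gnp_ge0 (n := n) G p01.
have tot : 1 <= Pr (@gnp R n p) (fun G => (k0 <= #|G| < k1)%N) + tail.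
  rewrite -(gnp_sum1 n p); apply: (@Pr_leU _ (@gnp R n p) predT) => // G _.
  by case: (boolP (k0 <= #|G| < k1)%N) => //= /outside.
have tot1 : Pr (@gnp R n p) (fun G => (k0 <= #|G| < k1)%N) <= 1.
  by rewrite -(gnp_sum1 n p); apply: (@Pr_le _ (@gnp R n p) _ predT).
have Flo : Pr (@gnp R n p) (fun G => (k0 <= #|G| < ky)%N) <= F.
  by apply: Pr_le => // G /andP[_]; rewrite kyP.
have Fhi : F <= Pr (@gnp R n p) (fun G => (k0 <= #|G| < ky)%N) + tail.
  apply: Pr_leU => // G; rewrite kyP => h; rewrite h andbT.
  case: (boolP (k0 <= #|G|)%N) => //= h'; apply: outside.
  by rewrite negb_and h'.
have kyN := leq_trans ky1' k1N.
rewrite (Pr_gnp_card_itv _ _ k1N) in tot tot1.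
rewrite (Pr_gnp_card_itv _ _ kyN) in Flo Fhi.
have winy k : (k0 <= k < ky)%N -> `|k%:R - m%:R| <= A * s.
  by move=> /andP[h h']; apply: win; rewrite h (leq_trans h').
have k01 : (k0 <= k1)%N by rewrite /k0 /k1 leqW // (leq_trans (leq_subr _ _)) ?leq_addr.
have := binom_window p01 mp sE A1 s1 As k0y winy.
have := binom_window p01 mp sE A1 s1 As k01 win.
rewrite -/theta; set W := window_scale _ _ _ _.
set x0 := (k0%:R - _) / s; set x1 := (k1%:R - _) / s; set xy := (ky%:R - _) / s.
have W0 : 0 < W by exact: (divr_gt0 (mulr_gt0 (binom_pmf_gt0 p01 N0) s0) (normal_peak1_gt0 R)).
have x0A : normal_cdf x0 <= normal_cdf (1 - A).
  by apply: normal_cdf_le; rewrite /x0 ler_pdivrMr // k0E; clear -s0 s1 J2; lra.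
have x1A : normal_cdf A <= normal_cdf x1.
  by apply: normal_cdf_le; rewrite /x1 ler_pdivlMr // k1E; clear -J2; lra.
have xy1 : normal_cdf y <= normal_cdf xy.
  by apply: normal_cdf_le; rewrite /xy ler_pdivlMr // kyE; clear -ky2 kyE; lra.
have xy2 : normal_cdf xy <= normal_cdf (y + s^-1).
  apply: normal_cdf_le; rewrite /xy ler_pdivrMr // mulrDl mulVf ?gt_eqF // kyE.
  by clear -ky1; lra.
have x00 := normal_cdf_ge0 x0; have x11 := normal_cdf_le1 x1.
have yA' : normal_cdf (1 - A) <= normal_cdf y.
  by apply: normal_cdf_le; clear -ny yA; lra.
have e0 := expR_gt0 theta; have e0' := expR_gt0 (- theta).
have ee : expR (- theta) * expR theta = 1 by rewrite -expRD addrC subrr expR0.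
have dA : normal_cdf (1 - A) <= normal_cdf A.
  by apply: normal_cdf_le; clear -A1; lra.
have yh0 := normal_cdf_ge0 (y + s^-1).
move=> /andP[t1 t2] /andP[u1 u2].
have -> : 2 * theta = theta + theta by ring.
rewrite opprD !expRD.
move: (expR theta) (expR (- theta)) e0 e0' ee t1 t2 u1 u2 => e e' e0 e0' ee t1 t2 u1 u2.
exact: (eliminate_scale W0 e0 e0' ee x00 x11 x0A x1A xy1 xy2 yA' dA yh0
  tailA tot tot1 Flo Fhi t1 t2 u1 u2).
Qed.

End DeMoivreLaplace.

(** * Means in the two models *)

Section MeanRatio.
Variable R : realType.

Lemma ln_prod (I : finType) (F : I -> R) : (forall i, 0 < F i) ->
  ln (\prod_i F i) = \sum_i ln (F i).
Proof.
move=> F0; suff [] : 0 < \prod_i F i /\ ln (\prod_i F i) = \sum_i ln (F i) by [].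
elim/big_rec2: _ => [|i x y _ [x0 <-]]; first by rewrite ln1.
by split; [rewrite mulr_gt0 | rewrite lnM ?posrE].
Qed.

(** The quotient is the product over [i < n] of [1 + u i] with
[u i = (j - i (1 - p)) / (m - i p)] and [j = k - m].  To first order
[ln (1 + u i)] is [(j - i (1 - p)) / m], and these sum to [n j / m - (1 - p) / p]
because [m = p N] and [N] is the sum of the [i]. *)
Lemma ln_mean_ratio (n m k : nat) (p B : R) : (1 < n)%N -> 0 < p < 1 ->
  m%:R = p * 'C(n, 2)%:R -> (k <= 'C(n, 2))%N ->
  `|k%:R - m%:R| + n%:R <= B -> 4 * B <= m%:R ->
  0 < ((k ^_ n)%:R / ('C(n, 2) ^_ n)%:R) / p ^+ n /\
  `|ln (((k ^_ n)%:R / ('C(n, 2) ^_ n)%:R) / p ^+ n) + (1 - p) / p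
     - n%:R * (k%:R - m%:R) / m%:R| <= 10 * n%:R * B ^+ 2 / m%:R ^+ 2.
Proof.
move=> n1 /andP[p0 p1] mp kN jB Bm; set N := 'C(n, 2) in mp kN *.
set j := k%:R - m%:R in jB *.
have n0 : 1 < n%:R :> R by rewrite ltr1n.
have j0 : 0 <= `|j| by [].
have m0 : 0 < m%:R :> R by lra.
have N0 : 0 < N%:R :> R by move: m0; rewrite mp pmulr_rgt0.
have mN : m%:R <= N%:R :> R by rewrite mp ler_piMl // ltW.
have /andP[jlo jhi] : - `|j| <= j <= `|j| by rewrite -ler_norml.
have kn : (n <= k)%N by rewrite -(ler_nat R); rewrite /j in jlo jhi jB *; lra.
pose u (i : 'I_n) := (j - i%:R * (1 - p)) / (m%:R - i%:R * p).
have iP (i : 'I_n) : (0 : R) <= i%:R /\ i%:R + 1 <= n%:R :> R.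
  by split=> //; rewrite natr1 ler_nat.
have den (i : 'I_n) : m%:R / 2 <= m%:R - i%:R * p.
  have [i0 i1] := iP i; have : i%:R * p <= i%:R by rewrite ler_piMr // ltW.
  lra.
have den0 (i : 'I_n) : 0 < m%:R - i%:R * p by apply: lt_le_trans (den i); lra.
have num (i : 'I_n) : `|j - i%:R * (1 - p)| <= B.
  have [i0 i1] := iP i; apply: le_trans (ler_normB _ _) _.
  have : i%:R * (1 - p) <= i%:R by rewrite ler_piMr //; lra.
  have : 0 <= i%:R * (1 - p) by rewrite mulr_ge0 //; lra.
  by move=> ? ?; rewrite [X in _ + X]ger0_norm //; lra.
have uB (i : 'I_n) : `|u i| <= 2 * B / m%:R.
  rewrite /u normrM normfV (gtr0_norm (den0 i)) ler_pdivrMr //.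
  apply: le_trans (num i) _.
  have BE : 2 * B / m%:R * (m%:R / 2) = B by field; rewrite gt_eqF.
  rewrite -[leLHS]BE.
  rewrite ler_wpM2l // divr_ge0 ?(ltW m0) //; lra.
have B2 : 2 * B / m%:R <= 2^-1 by rewrite ler_pdivrMr //; lra.
have u0 (i : 'I_n) : 0 < 1 + u i.
  by have := le_trans (uB i) B2; rewrite ler_norml => /andP[? ?]; lra.
have rhoE : ((k ^_ n)%:R / (N ^_ n)%:R) / p ^+ n = \prod_(i < n) (1 + u i).
  rewrite ffact_ratioE // -[n in p ^+ n]card_ord -prodr_const -prodf_div.
  apply: eq_bigr => i _.
  have dE : (N%:R - i%:R) * p = m%:R - i%:R * p by rewrite mp; ring.
  by rewrite -mulrA -invfM dE /u /j; field; rewrite gt_eqF.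
rewrite rhoE; split; first by apply: prodr_gt0 => i _.
rewrite ln_prod //.
have sumE : \sum_(i < n) ((j - i%:R * (1 - p)) / m%:R) = n%:R * j / m%:R - (1 - p) / p.
  rewrite -mulr_suml sumrB sumr_const card_ord -mulr_natl -mulr_suml mulrBl.
  have -> : \sum_(i < n) i%:R = N%:R :> R.
    by rewrite -natr_sum -(big_mkord xpredT (fun i => i)) bin2_sum.
  by rewrite [in X in _ - X]mp; congr (_ - _); field; rewrite !gt_eqF.
have -> : \sum_(i < n) ln (1 + u i) + (1 - p) / p - n%:R * j / m%:R =
    \sum_(i < n) (ln (1 + u i) - (j - i%:R * (1 - p)) / m%:R).
  by rewrite sumrB sumE; ring.
have -> : 10 * n%:R * B ^+ 2 / m%:R ^+ 2 = \sum_(i < n) (10 * B ^+ 2 / m%:R ^+ 2).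
  by rewrite sumr_const card_ord -mulr_natl; ring.
apply: le_trans (ler_norm_sum _ _ _) _; apply: ler_sum => i _.
have [i0 i1] := iP i.
have -> : ln (1 + u i) - (j - i%:R * (1 - p)) / m%:R =
   (ln (1 + u i) - u i) + u i * (i%:R * p / m%:R).
  by rewrite /u; field; rewrite !gt_eqF.
apply: le_trans (ler_normD _ _) _.
have lnu := ln1D_approx (le_trans (uB i) B2).
have u2 : u i ^+ 2 <= (2 * B / m%:R) ^+ 2.
  by rewrite -real_normK ?num_real // ler_sqr ?nnegrE ?normr_ge0 // (le_trans _ (uB i)).
have w1 : `|u i * (i%:R * p / m%:R)| <= 2 * B / m%:R * (B / m%:R).
  rewrite normrM; apply: ler_pM => //.
  rewrite ger0_norm ?divr_ge0 ?mulr_ge0 ?(ltW p0) ?(ltW m0) // ler_wpM2r ?invr_ge0 ?(ltW m0) //.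
  have : i%:R * p <= i%:R by rewrite ler_piMr // ltW.
  lra.
have -> : 10 * B ^+ 2 / m%:R ^+ 2 = 2 * (2 * B / m%:R) ^+ 2 + 2 * B / m%:R * (B / m%:R).
  by field; rewrite gt_eqF.
lra.
Qed.

(** Conditionally on having [k] edges the binomial graph is uniform. *)
Lemma gnp_mixture n (p : R) (P : pred nat) (Q : nat -> pred (graph n)) (eta : R) :
  0 < p < 1 -> 0 <= eta ->
  (forall k, P k -> (k <= 'C(n, 2))%N -> Pr (gnm R k) (Q k) <= eta) ->
  Pr (gnp p) (fun G : graph n => P #|G| && Q #|G| G) <= eta.
Proof.
move=> p01 eta0 h; have /andP[p0 p1] := p01; set N := 'C(n, 2) in h *.
have gN (G : graph n) : (#|G| < N.+1)%N by rewrite ltnS /N -card_edge max_card.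
have gE (G : graph n) : gnp p G = binom_pmf N p #|G| * gnm R #|G| G.
  have cC : #|finset.setC G| = (N - #|G|)%N.
    by rewrite [LHS]cardsCs finset.setCK card_edge.
  rewrite /gnp /gnm cC eqxx /binom_pmf card_draws card_edge mul1r.
  have : 'C(N, #|G|)%:R != 0 :> R by rewrite pnatr_eq0 -lt0n bin_gt0 -ltnS.
  by move: ('C(N, _)%:R) (p ^+ _) ((1 - p) ^+ _) => c x y c0; field.
have -> : Pr (gnp p) (fun G : graph n => P #|G| && Q #|G| G) =
  \sum_(k < N.+1) \sum_(G : graph n) (binom_pmf N p k * gnm R k G * (P k && Q k G)%:R).
  rewrite exchange_big /= /Pr big_mkcond /=; apply: eq_bigr => G _.
  rewrite (bigD1 (Ordinal (gN G))) //= -gE big1 ?addr0 => [|k kG].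
    by case: (P _ && _); rewrite ?mulr1 ?mulr0.
  rewrite /gnm; case: eqP => [e|_]; last by rewrite !mul0r mulr0 mul0r.
  by case/eqP: kG; apply: val_inj.
apply: (@le_trans _ _ (\sum_(k < N.+1) binom_pmf N p k * eta)).
  apply: ler_sum => k _; have kN : (k <= N)%N by rewrite -ltnS.
  have b0 := ltW (binom_pmf_gt0 p01 kN).
  under eq_bigr do rewrite -mulrA; rewrite -mulr_sumr ler_wpM2l //.
  have [Pk|nPk] := boolP (P k).
    apply: le_trans (h k Pk kN); rewrite /Pr [leRHS]big_mkcond /=.
    by apply: ler_sum => G _; case: (Q k G); rewrite ?mulr1 ?mulr0.
  by rewrite big1 // => G _; rewrite /= mulr0.
rewrite -mulr_suml; have := Pr_gnp_card n p predT; rewrite /Pr /= gnp_sum1 => <-.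
by rewrite mul1r.
Qed.

Lemma Ex_gnp n (p : R) : (2 < n)%N -> 
  Ex (gnp p) (fun G : graph n => (num_hamilton_cycles G)%:R) =
  #|[set C : graph n | hamilton_cycle C]|%:R * p ^+ n.
Proof.
move=> n2; apply: (Ex_num_hamilton_cycles (f := fun k => p ^+ k)) => // S.
exact: Pr_gnp_subset.
Qed.

Lemma Ex_gnm n k : (2 < n)%N -> (k <= 'C(n, 2))%N ->
  Ex (gnm R k) (fun G : graph n => (num_hamilton_cycles G)%:R) =
  #|[set C : graph n | hamilton_cycle C]|%:R * ((k ^_ n)%:R / ('C(n, 2) ^_ n)%:R).
Proof.
move=> n2 kN.
apply: (Ex_num_hamilton_cycles (f := fun i => (k ^_ i)%:R / ('C(n, 2) ^_ i)%:R)) => // S.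
exact: Pr_gnm_subset.
Qed.

End MeanRatio.

(** * Approximation for a fixed number of vertices *)

Section FixedSize.
Variable R : realType.
Variables (n m : nat) (p A e1 : R).
Local Notation X := (fun G : graph n => (num_hamilton_cycles G)%:R : R).
Let s : R := Num.sqrt (m%:R * (1 - p)).
Let beta : R := Num.sqrt (2 * (1 - p) / p).
Let lambda : R := Ex (gnp p) X.
Let lnZ (G : graph n) : \bar R :=
  (lne (expR (beta ^+ 2 / 2) * X G / lambda)%:E / beta%:E)%E.
Let q : R := n%:R ^+ 3 / m%:R ^+ 2.
Hypotheses (n2 : (2 < n)%N) (p01 : 0 < p < 1) (mp : m%:R = p * 'C(n, 2)%:R).
Hypotheses (A0 : 0 < A) (e10 : 0 < e1 <= 2^-1) (Bm : 4 * (A * s + n%:R) <= m%:R).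

Definition lnZ_error : R :=
  (2 * e1 + 10 * n%:R * (A * s + n%:R) ^+ 2 / m%:R ^+ 2) / beta + A / (n%:R - 1).

(** The three factors of [X / lambda]: the quotient [X / mu_k], close to 1; the
quotient [mu_k / lambda], by [ln_mean_ratio]; and the slope [n s / m], which
differs from [beta] by a factor [sqrt (n / (n - 1))]. *)
Lemma lnZ_approx (G : graph n) : `|#|G|%:R - m%:R| <= A * s ->
  `|X G / Ex (gnm R #|G|) X - 1| <= e1 ->
  exists z, lnZ G = z%:E /\ `|z - (#|G|%:R - m%:R) / s| <= lnZ_error.
Proof.
move=> jA XG; have /andP[p0 p1] := p01; have /andP[e1p e1h] := e10.
set k := #|G| in jA XG *; set j := k%:R - m%:R in jA *.
have kN : (k <= 'C(n, 2))%N by rewrite -card_edge max_card.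
have n0 : 3 <= n%:R :> R by rewrite ler_nat.
have jB : `|j| + n%:R <= A * s + n%:R by rewrite lerD2r.
have [rho0 lnrho] := ln_mean_ratio (ltnW n2) p01 mp kN jB Bm.
have Bm' := Bm; set B := A * s + n%:R in Bm' jB lnrho.
have h0 : 0 < #|[set C : graph n | hamilton_cycle C]|%:R :> R.
  by rewrite ltr0n hamilton_cycles_gt0.
have lambdaE : lambda = #|[set C : graph n | hamilton_cycle C]|%:R * p ^+ n := Ex_gnp _ n2.
have muE := Ex_gnm R n2 kN.
set mu := Ex (gnm R k) X in XG muE.
set h := #|_|%:R in h0 lambdaE muE; set r := (k ^_ n)%:R / _ in rho0 lnrho muE.
have pn0 : 0 < p ^+ n by rewrite exprn_gt0.
have r0 : 0 < r by move: rho0; rewrite pmulr_lgt0 ?invr_gt0.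
have mu0 : 0 < mu by rewrite muE mulr_gt0.
have q0 : 0 < 1 - p by rewrite subr_gt0.
have As0 : 0 <= A * s by rewrite mulr_ge0 ?(ltW A0) ?sqrtr_ge0.
have m0 : 0 < m%:R :> R by rewrite /B in Bm'; lra.
have s0 : 0 < s by rewrite sqrtr_gt0 mulr_gt0.
have s2 : s ^+ 2 = m%:R * (1 - p) by rewrite sqr_sqrtr // mulr_ge0 // ltW.
have b20 : 0 < 2 * (1 - p) / p by rewrite divr_gt0 ?mulr_gt0.
have b0 : 0 < beta by rewrite sqrtr_gt0.
have b2 : beta ^+ 2 = 2 * (1 - p) / p by rewrite sqr_sqrtr // ltW.
have [y yE] : exists y, X G / mu = 1 + y by exists (X G / mu - 1); ring.
have yA : `|y| <= e1 by move: XG; rewrite yE addrAC subrr add0r.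
have y1 : 0 < 1 + y by move: yA e1h; rewrite ler_norml => /andP[]; lra.
have ZE : expR (beta ^+ 2 / 2) * X G / lambda = expR (beta ^+ 2 / 2) * (1 + y) * (r / p ^+ n).
  by rewrite -yE lambdaE muE; field; rewrite !gt_eqF.
have Z0 : 0 < expR (beta ^+ 2 / 2) * (1 + y) by rewrite mulr_gt0 ?expR_gt0.
pose z := (beta ^+ 2 / 2 + ln (1 + y) + ln (r / p ^+ n)) / beta.
exists z; split.
  have e0 := expR_gt0 (beta ^+ 2 / 2).
  rewrite /lnZ ZE (lne_EFin (mulr_gt0 Z0 rho0)) (@lnM _ _ (r / _)) ?posrE //.
  by rewrite (@lnM _ _ (1 + y)) ?posrE // expRK inver gt_eqF // -EFinM.
have lny := ln1D_le yA e1h.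
have n1 : 0 < n%:R - 1 :> R by rewrite subr_gt0 ltr1n ltnW.
have f1 : 1 <= n%:R / (n%:R - 1) :> R by rewrite ler_pdivlMr // mul1r gerBl.
(* [n s / m] and [beta] differ because [N] is [n (n - 1) / 2], not [n^2 / 2]. *)
have slope2 : (n%:R * s / m%:R) ^+ 2 = beta ^+ 2 * (n%:R / (n%:R - 1)).
  rewrite b2 exprMn exprMn exprVn s2 mp natr_bin2; field.
  by rewrite !gt_eqF // ltr0n ltnW // ltnW.
have slope0 : 0 <= n%:R * s / m%:R by rewrite divr_ge0 ?mulr_ge0 // ltW.
have slope_lo : beta <= n%:R * s / m%:R.
  by rewrite -ler_sqr ?nnegrE ?(ltW b0) // slope2 ler_peMr ?sqr_ge0.
have slope_hi : n%:R * s / m%:R <= beta + beta / (n%:R - 1).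
  have -> : beta + beta / (n%:R - 1) = beta * (n%:R / (n%:R - 1)).
    by field; rewrite gt_eqF.
  have f0 := le_trans ler01 f1.
  rewrite -ler_sqr ?nnegrE //; last by rewrite mulr_ge0 // ltW.
  by rewrite slope2 exprMn ler_wpM2l ?sqr_ge0 // expr2 ler_peMl.
have xi : `|j / s| <= A by rewrite normrM normfV (gtr0_norm s0) ler_pdivrMr.
have zE : z - j / s =
   (ln (1 + y) + (ln (r / p ^+ n) + (1 - p) / p - n%:R * j / m%:R)) / beta +
   (j / s) * ((n%:R * s / m%:R - beta) / beta).
  have -> : (1 - p) / p = beta ^+ 2 / 2 by rewrite b2; field; rewrite gt_eqF.
  by rewrite /z; field; rewrite !gt_eqF.
rewrite zE /lnZ_error; apply: le_trans (ler_normD _ _) _; apply: lerD.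
  rewrite normrM normfV (gtr0_norm b0) ler_wpM2r ?invr_ge0 ?(ltW b0) //.
  by apply: le_trans (ler_normD _ _) _; apply: lerD.
rewrite normrM; apply: ler_pM => //.
rewrite ger0_norm; last by rewrite divr_ge0 ?(ltW b0) // subr_ge0.
by rewrite ler_pdivrMr // lerBlDl [_^-1 * _]mulrC.
Qed.

Let F (y : R) := Pr (gnp p) (fun G : graph n => (#|G|%:R - m%:R) / s <= y).
Let eta : R := (expR (16 * q) * (1 + 80 * q) - 1) / e1 ^+ 2.
Hypotheses (nm : (8 * n <= m)%N).

(** The exceptional event is the union of a large deviation of the number of edges
and, for a typical number of edges, a failure of concentration. *)
Lemma lnZ_cdf_sandwich (e x : R) : lnZ_error <= e ->
  Pr (gnp p) (fun G => (lnZ G <= x%:E)%E) <= F (x + e) + ((A ^+ 2)^-1 + eta) /\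
  F (x - e) <= Pr (gnp p) (fun G => (lnZ G <= x%:E)%E) + ((A ^+ 2)^-1 + eta).
Proof.
move=> err; have /andP[p0 p1] := p01; have /andP[e1p e1h] := e10.
have As0 : 0 <= A * s by rewrite mulr_ge0 ?(ltW A0) ?sqrtr_ge0.
have n0 : 0 < n%:R :> R by rewrite ltr0n (ltn_trans _ n2).
have Bm' := Bm.
have m0 : 0 < m%:R :> R by lra.
have mq0 : 0 < m%:R * (1 - p) by rewrite mulr_gt0 // subr_gt0.
have s2 : s ^+ 2 = m%:R * (1 - p) by rewrite sqr_sqrtr // ltW.
pose bad1 (G : graph n) := A ^+ 2 * (m%:R * (1 - p)) < (#|G|%:R - m%:R) ^+ 2.
pose near_m (k : nat) := `|k%:R - m%:R| <= A * s.
pose off (k : nat) (G : graph n) := e1 < `|X G / Ex (gnm R k) X - 1|.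
pose bad2 (G : graph n) := near_m #|G| && off #|G| G.
have P1 : Pr (gnp p) bad1 <= (A ^+ 2)^-1.
  by have := @gnp_edges_tail R n p A p01 A0; rewrite -mp; apply.
have q0 : 0 <= q by rewrite divr_ge0 ?exprn_ge0.
have P2 : Pr (gnp p) bad2 <= eta.
  apply: (gnp_mixture (P := near_m) (Q := off)) => //.
    rewrite divr_ge0 ?sqr_ge0 // subr_ge0 -[leLHS]mulr1.
    by apply: ler_pM => //; rewrite -?expR0 ?ler_expR ?lerDl mulr_ge0.
  move=> k km kN; have k2 : m%:R / 2 <= k%:R :> R.
    by move: km; rewrite /near_m ler_norml => /andP[? ?]; lra.
  have nk : (4 * n <= k <= 'C(n, 2))%N.
    rewrite kN andbT -(ler_nat R) natrM; apply: le_trans k2.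
    have : (8 * n)%:R <= m%:R :> R by rewrite ler_nat.
    rewrite natrM; lra.
  apply: le_trans (gnm_concentration n2 nk e1p) _.
  rewrite ler_wpM2r ?invr_ge0 ?sqr_ge0 // lerB //.
  have k0 : 0 < k%:R :> R by lra.
  (* [k >= m / 2] costs a factor 4 in [q]. *)
  have qk : n%:R ^+ 3 / k%:R ^+ 2 <= 4 * q.
    have -> : 4 * q = n%:R ^+ 3 * (4 / m%:R ^+ 2) by rewrite /q; ring.
    rewrite ler_wpM2l ?exprn_ge0 // -[leLHS]mul1r ler_pdivrMr ?exprn_gt0 //.
    rewrite mulrAC ler_pdivlMr ?exprn_gt0 // mul1r.
    have -> : 4 * k%:R ^+ 2 = (2 * k%:R) ^+ 2 :> R by ring.
    by rewrite ler_sqr ?nnegrE ?mulr_ge0 ?(ltW m0) ?(ltW k0) //; lra.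
  have qk0 : 0 <= n%:R ^+ 3 / k%:R ^+ 2 :> R by rewrite divr_ge0 ?exprn_ge0.
  apply: ler_pM; rewrite ?expR_ge0 ?ler_expR //; lra.
have cover G : ~~ bad1 G -> ~~ bad2 G ->
    exists z, lnZ G = z%:E /\ `|z - (#|G|%:R - m%:R) / s| <= e.
  rewrite /bad1 -leNgt -s2 -exprMn -real_normK ?num_real // ler_sqr ?nnegrE //.
  move=> near1; rewrite /bad2 /near_m near1 /= /off -leNgt => XG.
  by have [z [zE ze]] := lnZ_approx near1 XG; exists z; split=> //; apply: le_trans err.
have w0 G : 0 <= gnp p G := gnp_ge0 (n := n) G p01.
have P12 : Pr (gnp p) (fun G => bad1 G || bad2 G) <= (A ^+ 2)^-1 + eta.
  by apply: le_trans (lerD P1 P2); apply: Pr_leU.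
split.
  apply: le_trans (lerD (lexx _) P12); apply: Pr_leU => // G.
  case: (boolP (bad1 G)) => [|b1]; first by rewrite orbT.
  case: (boolP (bad2 G)) => [|b2]; first by rewrite !orbT.
  have [z [-> +]] := cover G b1 b2; rewrite lee_fin orbF ler_norml => /andP[? ?] ?.
  lra.
apply: le_trans (lerD (lexx _) P12); apply: Pr_leU => // G.
case: (boolP (bad1 G)) => [|b1]; first by rewrite orbT.
case: (boolP (bad2 G)) => [|b2]; first by rewrite !orbT.
have [z [-> +]] := cover G b1 b2; rewrite lee_fin orbF ler_norml => /andP[? ?] ?.
lra.
Qed.

End FixedSize.

(** * Limits *)

Section Limits.
Local Open Scope classical_set_scope.
Variable R : realType.

Lemma expR_le1D2x (x : R) : 0 <= x <= 2^-1 -> expR x <= 1 + 2 * x.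
Proof.
move=> /andP[x0 x1]; have := expR_ge1Dx (- x); rewrite expRN => h.
have e0 := expR_gt0 x.
have : expR x * (1 - x) <= 1.
  by apply: le_trans (ler_wpM2l (ltW e0) h) _; rewrite divff // gt_eqF.
have : 1 <= expR x by apply: le_trans (expR_ge1Dx x); lra.
move: (expR x) => e *; nra.
Qed.

Lemma Pr_ge0 (T : finType) (w : T -> R) (P : pred T) : (forall x, 0 <= w x) -> 0 <= Pr w P.
Proof. by move=> w0; apply: sumr_ge0. Qed.

(** First choose the half-width [A] of the window so large that both tails are
small; for this fixed [A] the errors [theta] and [1 / s] vanish in the limit. *)
Lemma de_moivre_laplace (p : nat -> R) (m : nat -> nat) (y : R)
  (s := fun n => Num.sqrt ((m n)%:R * (1 - p n))) :
  (\forall n \near \oo, 0 < p n < 1) ->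
  (\forall n \near \oo, (m n)%:R = p n * 'C(n, 2)%:R) ->
  s n @[n --> \oo] --> +oo ->
  Pr (gnp (p n)) (fun G : graph n => (#|G|%:R - (m n)%:R) / s n <= y) @[n --> \oo]
    --> normal_cdf y.
Proof.
move=> hp hmp hs; apply/cvgrPdist_le => eps eps0.
(* Six errors of size [d] add up in the estimate of [F]. *)
pose d := Num.min (eps / 6) 2^-1.
have d0 : 0 < d by rewrite /d lt_min; apply/andP; split; lra.
have d1 : d <= 2^-1 by rewrite /d ge_min lexx orbT.
have d2 : d <= eps / 6 by rewrite /d ge_min lexx.
have [A [A1 yA Ad tA]] : exists A : R, [/\ 1 <= A, `|y| + 1 <= A, (A ^+ 2)^-1 <= d &
    1 - d <= normal_cdf A /\ normal_cdf (1 - A) <= d].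
  near (pinfty_nbhs R) => A; exists A.
  have A1 : 1 <= A by near: A; apply: nbhs_pinfty_ge; rewrite num_real.
  split.
  - exact: A1.
  - by near: A; apply: nbhs_pinfty_ge; rewrite num_real.
  - have : d^-1 <= A by near: A; apply: nbhs_pinfty_ge; rewrite num_real.
    move=> dA; rewrite -[d]invrK lef_pV2 ?posrE ?invr_gt0 ?exprn_gt0 ?(lt_le_trans _ A1) //.
    by apply: le_trans dA _; rewrite expr2 ler_peMl //; lra.
  - by near: A; exact: normal_cdf_tails.
move/cvgryPge : hs => hs; have c0 := @normal_peak1_gt0 R.
set cs := 4 * A ^+ 3 + 2 * A + 1.
have cs0 : 0 < cs.
  have A0 : 0 < A by lra.
  by rewrite /cs ltr_wpDl // addr_ge0 ?mulr_ge0 ?exprn_ge0 // ltW.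
near=> n.
have p01 : 0 < p n < 1 by near: n.
have mp : (m n)%:R = p n * 'C(n, 2)%:R by near: n.
have s1 : 1 <= s n by near: n; exact: hs.
have As : 2 * A <= s n by near: n; exact: hs.
have s3 : 4 * cs / d <= s n by near: n; exact: hs.
have s4 : normal_peak 1 / d <= s n by near: n; exact: hs.
have s0 : 0 < s n by lra.
have s2 : s n ^+ 2 = (m n)%:R * (1 - p n).
  by have /andP[_ p1] := p01; rewrite sqr_sqrtr // mulr_ge0 // subr_ge0 ltW.
have [lo hi] := de_moivre_laplace_bounds p01 mp s2 A1 s1 As yA.
set F := Pr _ _ in lo hi *; set theta := _ / s n in lo hi.
have th0 : 0 <= theta by rewrite divr_ge0 // ltW.
have thd : 4 * theta <= d.
  by rewrite /theta -/cs mulrA ler_pdivrMr // [leRHS]mulrC -ler_pdivrMr.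
have e1 : expR (2 * theta) <= 1 + d.
  have th2 : 0 <= 2 * theta <= 2^-1 by clear -th0 thd d1; apply/andP; split; lra.
  by apply: le_trans (expR_le1D2x th2) _; clear -thd; lra.
have e2 : 1 - d <= expR (- (2 * theta)).
  by apply: le_trans (expR_ge1Dx _); clear -thd th0; lra.
have hd : normal_cdf (y + (s n)^-1) <= normal_cdf y + d.
  have si : 0 <= (s n)^-1 by rewrite invr_ge0 ltW.
  apply: le_trans (normal_cdf_lip y si) _.
  by rewrite lerD2l ler_pdivrMr // mulrC -ler_pdivrMr.
have y0 := normal_cdf_ge0 y; have y1 := normal_cdf_le1 y.
have yh0 := normal_cdf_ge0 (y + (s n)^-1).
have [tA1 tA2] := tA.
have yA' : normal_cdf (1 - A) <= normal_cdf y.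
  by apply: normal_cdf_le; have := ler_norm (- y); rewrite normrN; clear -yA; lra.
have F0 : 0 <= F by apply: Pr_ge0 => G; exact: gnp_ge0.
have F1 : F <= 1.
  by rewrite -(gnp_sum1 n (p n)); apply: (@Pr_le _ _ (gnp (p n)) _ predT) => // G; exact: gnp_ge0.
suff : `|normal_cdf y - F| <= 6 * d by clear -d2; lra.
move: lo hi e1 e2 hd y0 y1 yh0 tA1 tA2 yA' F0 F1 Ad d0 d1.
clear; move: (expR (2 * theta)) (expR (- (2 * theta))) F (normal_cdf (y + _)) (normal_cdf y)
   (normal_cdf A) (normal_cdf (1 - A)) ((A ^+ 2)^-1) d.
clear; move=> E E' F ch cy cA cN a d lo hi e1 e2 hd y0 y1 yh0 tA1 tA2 yA' F0 F1 Ad d0 d1.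
rewrite ler_norml; apply/andP; split.
  suff : F <= cy + 6 * d by lra.
  have [Fd|dF] := leP F d; first lra.
  have h1 : (F - d) * (1 - 2 * d) <= (F - a) * (cA - cN) by apply: ler_pM; lra.
  have h2 : E * ch <= (1 + d) * (cy + d).
    have [E0|E0] := leP 0 E; first by apply: ler_pM.
    apply: (@le_trans _ _ 0); last by rewrite mulr_ge0; lra.
    by rewrite mulr_le0_ge0 // ltW.
  nra.
suff : cy - 6 * d <= F by lra.
have h1 : (1 - d) * (1 - d) <= E' * (1 - a) by apply: ler_pM; lra.
have h2 : (1 - d) * (1 - d) * (cy - cN) <= E' * (1 - a) * (cy - cN).
  by rewrite ler_wpM2r // subr_ge0.
have h3 : (1 - 2 * d) * (cy - cN) <= (1 - d) * (1 - d) * (cy - cN).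
  by rewrite ler_wpM2r ?subr_ge0 //; nra.
nra.
Unshelve. all: by end_near. Qed.

Section Density.
Variables (p : nat -> R) (m : nat -> nat).
Hypothesis hp : \forall n \near \oo, 0 < p n < 1.
Hypothesis hmp : \forall n \near \oo, (m n)%:R = p n * 'C(n, 2)%:R.
Hypothesis hpn : (fun n : nat => (n%:R `^ (- 2^-1))%R : R) =o_\oo p.

(** Since [m] is at least [p n^2 / 4], the quotient is at most [16 / (n p^2)]. *)
Lemma cube_over_square_small (c : R) : 0 < c -> \forall n \near \oo, n%:R ^+ 3 / (m n)%:R ^+ 2 <= c.
Proof.
move=> c0; have /eqoP := hpn.
have d0 : 0 < Num.sqrt (c / 16) by rewrite sqrtr_gt0 divr_gt0.
move=> /(_ _ d0) hpd; near=> n.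
have p01 : 0 < p n < 1 by near: n.
have mp : (m n)%:R = p n * 'C(n, 2)%:R by near: n.
have n2 : 2 <= n%:R :> R by near: n; exact: nbhs_infty_ger.
have /= pd : `|n%:R `^ (- 2^-1)| <= Num.sqrt (c / 16) * `|p n| by near: n.
have /andP[p0 p1] := p01.
have n0 : 0 < n%:R :> R by lra.
have {}pd : n%:R^-1 <= c / 16 * p n ^+ 2.
  move: pd; rewrite (gtr0_norm p0) ger0_norm ?powR_ge0 // => pd.
  have -> : c / 16 * p n ^+ 2 = (Num.sqrt (c / 16) * p n) ^+ 2.
    by rewrite exprMn sqr_sqrtr // divr_ge0 // ltW.
  have -> : n%:R^-1 = (n%:R `^ (- 2^-1)) ^+ 2 :> R.
    rewrite -powR_mulrn ?powR_ge0 // -powRrM.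
    have -> : - 2^-1 * 2%:R = -1 :> R by rewrite mulNr mulVf.
    by rewrite powR_inv1 // ltW.
  by rewrite ler_sqr ?nnegrE ?powR_ge0 // mulr_ge0 ?sqrtr_ge0 // ltW.
have m0 : p n * (n%:R ^+ 2 / 4) <= (m n)%:R.
  by rewrite mp natr_bin2 ler_wpM2l ?(ltW p0) //; nra.
have m1 : 0 < p n * (n%:R ^+ 2 / 4) by rewrite !mulr_gt0 ?exprn_gt0 ?invr_gt0.
have mm : 0 < (m n)%:R :> R by apply: lt_le_trans m0.
rewrite ler_pdivrMr ?exprn_gt0 //.
apply: (@le_trans _ _ (c * (p n * (n%:R ^+ 2 / 4)) ^+ 2)); last first.
  by rewrite ler_wpM2l ?(ltW c0) // ler_sqr ?nnegrE // ltW.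
have -> : c * (p n * (n%:R ^+ 2 / 4)) ^+ 2 = n%:R ^+ 4 * (c / 16 * p n ^+ 2) by field.
have -> : n%:R ^+ 3 = n%:R ^+ 4 * n%:R^-1 :> R by field; rewrite gt_eqF.
by rewrite ler_wpM2l ?exprn_ge0.
Unshelve. all: by end_near. Qed.

Lemma edges_superlinear : \forall n \near \oo, (8 * n <= m n)%N.
Proof.
near=> n.
have q1 : n%:R ^+ 3 / (m n)%:R ^+ 2 <= 1 :> R by near: n; exact: cube_over_square_small.
have p01 : 0 < p n < 1 by near: n.
have mp : (m n)%:R = p n * 'C(n, 2)%:R by near: n.
have n64 : 64 <= n%:R :> R by near: n; exact: nbhs_infty_ger.
have m0 : 0 < (m n)%:R :> R.
  have /andP[p0 _] := p01; rewrite mp mulr_gt0 // natr_bin2 divr_gt0 // mulr_gt0; lra.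
rewrite -(ler_nat R) natrM -ler_sqr ?nnegrE ?mulr_ge0 //.
move: q1; rewrite ler_pdivrMr ?exprn_gt0 // mul1r; apply: le_trans.
by rewrite exprMn (exprS _ 2) ler_wpM2r ?sqr_ge0 //; lra.
Unshelve. all: by end_near. Qed.

(** This gap keeps [beta] away from 0 and makes the variance of the number of edges
tend to infinity. *)
Lemma limn_esup_lt1_gap : (limn_esup (fun n => (p n)%:E) < 1)%E ->
  exists2 d : R, 0 < d & \forall n \near \oo, p n <= 1 - d.
Proof.
rewrite /limn_esup /limf_esup => /ereal_inf_lt[_ [V Voo <-] supV].
have [r supr r1] : exists2 r : R, (ereal_sup ((fun n => (p n)%:E) @` V) <= r%:E)%E & r < 1.
  move: supV; case: (ereal_sup _) => [r|//|_]; rewrite ?lte_fin.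
    by exists r.
  by exists 0; rewrite ?leNye // ltr01.
exists (1 - r); first by rewrite subr_gt0.
apply: filterS Voo => n Vn; rewrite opprB addrCA subrr addr0 -lee_fin.
by apply: le_trans supr; apply: ereal_sup_ubound; exists n.
Qed.

End Density.
End Limits.

(** * The theorem *)

Local Open Scope classical_set_scope.

Lemma concentration_bound_le (R : realType) (x c eps : R) :
  0 <= x <= 2^-1 -> 0 < eps -> 12 * x <= c * eps ^+ 2 ->
  (expR x * (1 + 5 * x) - 1) / eps ^+ 2 <= c.
Proof.
move=> /andP[x0 x1] eps0 xc; rewrite ler_pdivrMr ?exprn_gt0 //.
apply: le_trans xc; have h : expR x <= 1 + 2 * x by apply: expR_le1D2x; rewrite x0.
have : expR x * (1 + 5 * x) <= (1 + 2 * x) * (1 + 5 * x).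
  by rewrite ler_wpM2r //; lra.
move: (expR _ * _) => E; nra.
Qed.

(** Apart from the term in [e1], the errors are of order [q] or [1 / n]; in
particular [n / m <= q / 2], because [m <= N <= n^2 / 2]. *)
Lemma lnZ_error_le (R : realType) (n m : nat) (p A e e1 b d : R)
  (s := Num.sqrt (m%:R * (1 - p))) (q := n%:R ^+ 3 / m%:R ^+ 2) :
  (2 < n)%N -> 0 < p < 1 -> m%:R = p * 'C(n, 2)%:R -> 0 < A -> 0 < e1 -> 0 < d ->
  b = (Num.sqrt (2 * d))^-1 -> p <= 1 - d -> (8 * n <= m)%N ->
  64 * A ^+ 2 <= n%:R -> 4 * A / e + 1 <= n%:R -> 0 < e ->
  2 * e1 * b <= e / 2 -> q <= e / (4 * b * (10 * A ^+ 2 + 20)) ->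
  4 * (A * s + n%:R) <= m%:R /\ lnZ_error n m p A e1 <= e.
Proof.
move=> n2 /andP[p0 p1] mp A0 e10 d0 bE pd nm nA nA' e0 e1b q3.
have n0 : 3 <= n%:R :> R by rewrite ler_nat.
have nmR : 8 * n%:R <= m%:R :> R by rewrite -natrM ler_nat.
have m0 : 0 < m%:R :> R by apply: lt_le_trans nmR; rewrite mulr_gt0 // (lt_le_trans _ n0).
have s0 : 0 <= s := sqrtr_ge0 _.
have s2 : s ^+ 2 = m%:R * (1 - p) by rewrite sqr_sqrtr // mulr_ge0 // subr_ge0 ltW.
have sm : s ^+ 2 <= m%:R by rewrite s2 ler_piMr // lerBlDr lerDl ltW.
have As : 4 * (A * s) <= m%:R / 2.
  rewrite -ler_sqr ?nnegrE ?divr_ge0 ?mulr_ge0 ?(ltW A0) ?(ltW m0) //.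
  have -> : (4 * (A * s)) ^+ 2 = 16 * A ^+ 2 * s ^+ 2 by ring.
  have -> : (m%:R / 2) ^+ 2 = m%:R / 4 * m%:R :> R by field.
  by apply: ler_pM; rewrite ?mulr_ge0 ?sqr_ge0 //; lra.
have Bm : 4 * (A * s + n%:R) <= m%:R by lra.
split=> //; rewrite /lnZ_error -/s; set beta := Num.sqrt (2 * _ / p).
set B := A * s + n%:R in Bm *.
have b0 : 0 < b by rewrite bE invr_gt0 sqrtr_gt0 mulr_gt0.
have beta_ge : beta^-1 <= b.
  have dp : d <= (1 - p) / p.
    rewrite ler_pdivlMr //; have : d * p <= d by rewrite ler_piMr // ltW.
    lra.
  rewrite bE lef_pV2 ?posrE ?sqrtr_gt0 ?(mulr_gt0 _ d0) //; last first.
    by rewrite -mulrA mulr_gt0 // (lt_le_trans d0).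
  by rewrite ler_wsqrtr // -mulrA ler_pM2l.
have nmq : n%:R / m%:R <= q / 2.
  have -> : n%:R / m%:R = n%:R * m%:R / m%:R ^+ 2 :> R by field; rewrite gt_eqF.
  rewrite /q [leRHS]mulrAC ler_wpM2r ?invr_ge0 ?exprn_ge0 // (exprS _ 2) -mulrA ler_wpM2l //.
  have : m%:R <= 'C(n, 2)%:R :> R by rewrite mp ler_piMl // ltW.
  rewrite natr_bin2 expr2; lra.
have t1 : 10 * n%:R * B ^+ 2 / m%:R ^+ 2 <= (10 * A ^+ 2 + 20) * q.
  have B2 : B ^+ 2 <= 2 * A ^+ 2 * m%:R + 2 * n%:R ^+ 2.
    have : 0 <= (A * s - n%:R) ^+ 2 by rewrite sqr_ge0.
    have : A ^+ 2 * s ^+ 2 <= A ^+ 2 * m%:R by rewrite ler_wpM2l // sqr_ge0.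
    rewrite /B; lra.
  apply: (@le_trans _ _ (20 * A ^+ 2 * (n%:R / m%:R) + 20 * q)).
    have -> : 20 * A ^+ 2 * (n%:R / m%:R) + 20 * q =
       10 * n%:R * (2 * A ^+ 2 * m%:R + 2 * n%:R ^+ 2) / m%:R ^+ 2.
      by rewrite /q; field; rewrite gt_eqF.
    by rewrite ler_wpM2r ?invr_ge0 ?sqr_ge0 // ler_wpM2l // mulr_ge0.
  have : 20 * A ^+ 2 * (n%:R / m%:R) <= 20 * A ^+ 2 * (q / 2).
    by rewrite ler_wpM2l // mulr_ge0 // sqr_ge0.
  lra.
have c20 : 0 < 10 * A ^+ 2 + 20 by rewrite ltr_wpDl // mulr_ge0 // sqr_ge0.
have t2 : (10 * A ^+ 2 + 20) * q * b <= e / 4.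
  move: q3; rewrite ler_pdivlMr ?(mulr_gt0 _ c20) ?mulr_gt0 //.
  by move: (10 * _ + _) => c2; lra.
have t3 : A / (n%:R - 1) <= e / 4.
  have h : 4 * A / e <= n%:R - 1 by lra.
  have n1 : 0 < n%:R - 1 :> R by lra.
  by rewrite ler_pdivrMr //; move: h; rewrite ler_pdivrMr //; lra.
have t0 : 0 <= 10 * n%:R * B ^+ 2 / m%:R ^+ 2.
  by rewrite divr_ge0 ?sqr_ge0 // mulr_ge0 ?sqr_ge0 // mulr_ge0.
have t4 : (2 * e1 + 10 * n%:R * B ^+ 2 / m%:R ^+ 2) / beta <= (2 * e1 + (10 * A ^+ 2 + 20) * q) * b.
  have e20 : 0 <= 2 * e1 by rewrite mulr_ge0 // ltW.
  by apply: ler_pM; rewrite ?(addr_ge0 e20 t0) ?invr_ge0 ?sqrtr_ge0 ?lerD2l.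
lra.
Qed.

Theorem theorem8 (R : realType) (p : nat -> R) (m : nat -> nat)
  (hp : \forall n \near \oo, 0 < p n < 1)
  (hm : \forall n \near \oo, (0 < m n < 'C(n, 2))%N)
  (hmp : \forall n \near \oo, (m n)%:R = p n * 'C(n, 2)%:R)
  (hpn : (fun n : nat => (n%:R `^ (- 2^-1))%R : R) =o_\oo p) :
  let X (n : nat) (G : graph n) : R := (num_hamilton_cycles G)%:R in
  let mu (n : nat) : R := Ex (gnm R (m n)) (X n) in
  let lambda (n : nat) : R := Ex (gnp (p n)) (X n) in
  let beta (n : nat) : R := Num.sqrt (2 * (1 - p n) / p n) in
  let Y (n : nat) (G : graph n) : R := X n G / mu n in
  let Z (n : nat) (G : graph n) : R :=
    expR (beta n ^+ 2 / 2) * X n G / lambda n in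
  let lnZ (n : nat) (G : graph n) : \bar R :=
    (lne (Z n G)%:E / (beta n)%:E)%E in
  cvg_in_probability (fun n => gnm R (m n)) Y 1 /\
  ((limn_esup (fun n => (p n)%:E) < 1)%E ->
   cvg_in_distribution (fun n => gnp (p n)) lnZ (normal_prob 0 1)).
Proof.
move=> X mu lambda beta Y Z lnZ; pose q n : R := n%:R ^+ 3 / (m n)%:R ^+ 2.
have q_ge0 n : 0 <= q n by rewrite divr_ge0 ?exprn_ge0.
have q_small c : 0 < c -> \forall n \near \oo, q n <= c := cube_over_square_small hp hmp hpn (c:=c).
have big := edges_superlinear hp hmp hpn.
have n_big (c : R) : \forall n \near \oo, c <= n%:R := nbhs_infty_ger c.
split=> [eps eps0|hlim x _].
  apply/cvgrPdist_le => c c0; near=> n.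
  have n2 : (2 < n)%N by near: n; exact: nbhs_infty_ge.
  have nm : (8 * n <= m n)%N by near: n.
  have mN : (m n <= 'C(n, 2))%N.
    suff /andP[_ /ltnW] : (0 < m n < 'C(n, 2))%N by [].
    by near: n.
  have q1 : 4 * q n <= 2^-1.
    by rewrite mulrC -ler_pdivlMr //; near: n; apply: q_small; rewrite divr_gt0.
  have q2 : 12 * (4 * q n) <= c * eps ^+ 2.
    rewrite mulrA mulrC -ler_pdivlMr ?mulr_gt0 //; near: n; apply: q_small.
    by rewrite divr_gt0 ?mulr_gt0 ?exprn_gt0.
  have nm4 : (4 * n <= m n <= 'C(n, 2))%N.
    by rewrite mN andbT (leq_trans _ nm) // leq_mul2r orbT.
  have := gnm_concentration n2 nm4 eps0; rewrite -/(X n) -/(mu n) -/(q n) => le.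
  rewrite sub0r normrN ger0_norm; last by apply: Pr_ge0 => G; exact: gnm_ge0.
  apply: le_trans le _; have -> : 20 * q n = 5 * (4 * q n) by ring.
  by apply: concentration_bound_le; rewrite ?mulr_ge0 ?q1.
have [d d0 pd] := limn_esup_lt1_gap hlim.
pose s n := Num.sqrt ((m n)%:R * (1 - p n)).
have s_infty : s n @[n --> \oo] --> +oo.
  apply/cvgryPge => B; near=> n.
  have pdn : p n <= 1 - d by near: n.
  have nB : B ^+ 2 / d <= n%:R by near: n.
  have nm : (8 * n <= m n)%N by near: n.
  apply: le_trans (ler_norm B) _; rewrite -sqrtr_sqr ler_wsqrtr //.
  move: nB; rewrite ler_pdivrMr // => /le_trans; apply.
  apply: ler_pM; rewrite ?(ltW d0) //; last lra.
  by rewrite ler_nat (leq_trans _ nm) // leq_pmull.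
have F_cvg y := @de_moivre_laplace R p m y hp hmp s_infty.
have := normal_cdfE x; rewrite /= => ->; apply: cvg_EFin; first by near=> n.
apply/cvgrPdist_le => eps eps0 /=.
have c0 := @normal_peak1_gt0 R.
(* [normal_peak 1] is a Lipschitz constant of the distribution function, so a
   shift by [e] costs [eps / 4]; the tail [1 / A^2], the limit ([Flo] below, [Fhi]
   above) and the failure of concentration cost as much each. *)
pose e := eps / (4 * normal_peak 1).
have e0 : 0 < e by rewrite divr_gt0 ?mulr_gt0.
have lipE : normal_peak 1 * e = eps / 4 by rewrite /e; field; rewrite gt_eqF.
clearbody e.
pose b := (Num.sqrt (2 * d))^-1.
have b0 : 0 < b by rewrite invr_gt0 sqrtr_gt0 mulr_gt0.
have bE : b = (Num.sqrt (2 * d))^-1 by [].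
clearbody b.
(* [b] bounds [1 / beta]. *)
pose e1 := Num.min (e / (4 * b)) 2^-1.
have e1le : e1 <= e / (4 * b) by rewrite ge_min lexx.
have e10 : 0 < e1 by rewrite lt_min divr_gt0 ?mulr_gt0 // invr_gt0 ltr0n.
have e1h : 0 < e1 <= 2^-1 by rewrite e10 ge_min lexx orbT.
clearbody e1.
have e1b : 2 * e1 * b <= e / 2.
  by move: e1le; rewrite ler_pdivlMr ?mulr_gt0 //; lra.
pose A := Num.sqrt (4 / eps).
have A0 : 0 < A by rewrite sqrtr_gt0 divr_gt0.
have A2 : A ^+ 2 = 4 / eps by rewrite sqr_sqrtr // divr_ge0 // ltW.
have AV : (A ^+ 2)^-1 = eps / 4 by rewrite A2 invf_div.
clearbody A.
have c20 : 0 < 10 * A ^+ 2 + 20 by rewrite ltr_wpDl // mulr_ge0 // sqr_ge0.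
have Flo : \forall n \near \oo, `|normal_cdf (x - e) -
    Pr (gnp (p n)) (fun G : graph n => (#|G|%:R - (m n)%:R) / s n <= x - e)| <= eps / 4.
  by move/cvgrPdist_le : (F_cvg (x - e)); apply; rewrite divr_gt0.
have Fhi : \forall n \near \oo, `|normal_cdf (x + e) -
    Pr (gnp (p n)) (fun G : graph n => (#|G|%:R - (m n)%:R) / s n <= x + e)| <= eps / 4.
  by move/cvgrPdist_le : (F_cvg (x + e)); apply; rewrite divr_gt0.
near=> n.
have p01 : 0 < p n < 1 by near: n.
have mp : (m n)%:R = p n * 'C(n, 2)%:R by near: n.
have pdn : p n <= 1 - d by near: n.
have n2 : (2 < n)%N by near: n; exact: nbhs_infty_ge.
have nm : (8 * n <= m n)%N by near: n.
have q1 : 16 * q n <= 2^-1.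
  by rewrite mulrC -ler_pdivlMr //; near: n; apply: q_small; rewrite divr_gt0.
have q2 : 12 * (16 * q n) <= eps / 4 * e1 ^+ 2.
  rewrite mulrA mulrC -ler_pdivlMr ?mulr_gt0 //; near: n; apply: q_small.
  by rewrite divr_gt0 ?mulr_gt0 ?exprn_gt0 // divr_gt0.
have q3 : q n <= e / (4 * b * (10 * A ^+ 2 + 20)).
  by near: n; apply: q_small; rewrite !(divr_gt0, mulr_gt0).
have nA : 64 * A ^+ 2 <= n%:R by near: n.
have nA' : 4 * A / e + 1 <= n%:R by near: n.
have loF : `|normal_cdf (x - e) -
    Pr (gnp (p n)) (fun G : graph n => (#|G|%:R - (m n)%:R) / s n <= x - e)| <= eps / 4.
  by near: n.
have hiF : `|normal_cdf (x + e) -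
    Pr (gnp (p n)) (fun G : graph n => (#|G|%:R - (m n)%:R) / s n <= x + e)| <= eps / 4.
  by near: n.
have /andP[p0 p1] := p01.
have [Bm errE] := lnZ_error_le n2 p01 mp A0 e10 d0 bE pdn nm nA nA' e0 e1b q3.
have [up lo] := lnZ_cdf_sandwich n2 p01 mp A0 e1h Bm nm x errE.
rewrite AV -/(q n) -/(s n) in up lo.
have etaE : (expR (16 * q n) * (1 + 80 * q n) - 1) / e1 ^+ 2 <= eps / 4.
  have -> : 80 * q n = 5 * (16 * q n) by ring.
  by apply: concentration_bound_le; rewrite ?mulr_ge0 ?q1.
have lip1 := normal_cdf_lip x (ltW e0); have lip2 := normal_cdf_lip (x - e) (ltW e0).
rewrite subrK in lip2; rewrite lipE in lip1 lip2.
move: up lo loF hiF lip1 lip2 etaE.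
rewrite -/(X n) -/(lambda n) -/(beta n) -/(Z n) -/(lnZ n) -/(s n) !ler_norml.
move: (normal_cdf _) (normal_cdf _) (normal_cdf _) (Pr _ _) (Pr _ _) (Pr _ _) (_ / e1 ^+ 2).
clear; move=> c1 c2 c3 P1 P2 P3 eta up lo /andP[? ?] /andP[? ?] ? ? ?.
apply/andP; split; lra.
Unshelve. all: by end_near. Qed.
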